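(* Let $d\ge 2$. For $\kappa\in\mathbb{R}$ and $(x,t)\in\mathbb{R}^d\times\mathbb{R}$ let $$\mathcal W_\kappa(x,t)=\int_{\mathbb{R}^d}e^{i(x\cdot\xi+t|\xi|)}\,|\xi|^{-\frac{d+1}2+i\kappa}\,\chi(|\xi|)\,d\xi.$$ There exist constants $C<\infty$ and $N>0$ such that $$|\kappa\,\mathcal W_\kappa(x,t)|\le C(1+|\kappa|)^N|t|^{-\frac{d-1}2}$$ for all $\kappa\in\mathbb{R}$ and $(x,t)\in\mathbb{R}^d\times\mathbb{R}$.
   Context: $\chi$ denotes a fixed function in $C_c^\infty(-1,1)$ with $\chi=1$ on $(-\frac12,\frac12)$. The constants $C,N$ may depend on $d$ and $\chi$. For $t=0$ the right-hand side is interpreted as $+\infty$. *)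

(* Defs.v *)
From HB Require Import structures.
From mathcomp Require Import all_boot all_order all_algebra.
From mathcomp Require Import all_classical all_reals all_analysis.
From mathcomp Require Import complex.
Set Implicit Arguments.
Unset Strict Implicit.
Unset Printing Implicit Defensive.
Import Order.TTheory GRing.Theory Num.Theory.
Import numFieldNormedType.Exports.
Local Open Scope classical_set_scope.
Local Open Scope ring_scope.

Section tuple_cons.
Context {R : realType} {n : nat}.

Definition tuple_cons (p : R * n.-tuple R) : n.+1.-tuple R :=
  [tuple of p.1 :: p.2].

Definition tuple_uncons (v : n.+1.-tuple R) : R * n.-tuple R :=
  (thead v, [tuple of behead v]).

Lemma tuple_consK : cancel tuple_cons tuple_uncons.
Proof. by case=> a v; congr pair; apply/val_inj. Qed.

Lemma tuple_unconsK : cancel tuple_uncons tuple_cons.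
Proof. by move=> v; rewrite [v in RHS]tuple_eta. Qed.

Lemma measurable_tuple_cons : measurable_fun [set: R * n.-tuple R] tuple_cons.
Proof. exact: measurable_cons. Qed.

Lemma measurable_tuple_uncons : measurable_fun [set: n.+1.-tuple R] tuple_uncons.
Proof.
apply: measurable_fun_pair; last exact: measurable_behead.
exact: measurable_tnth.
Qed.

End tuple_cons.

Section cons_measure.
Local Open Scope ereal_scope.
Context {R : realType} {n : nat}.
Variable m : {sigma_finite_measure set (n.-tuple R) -> \bar R}.

Definition cons_measure : set (n.+1.-tuple R) -> \bar R :=
  pushforward (@lebesgue_measure R \x m) tuple_cons.

Let cons_measure0 : cons_measure set0 = 0.
Proof. by rewrite /cons_measure /pushforward preimage_set0 measure0. Qed.

Let cons_measure_ge0 A : 0 <= cons_measure A.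
Proof. exact: (measure_ge0 (@lebesgue_measure R \x m)). Qed.

Let cons_measure_sigma_additive : semi_sigma_additive cons_measure.
Proof.
apply: (@measure_semi_sigma_additive _ _ _
  (pushforward (@lebesgue_measure R \x m) tuple_cons : {measure set _ -> \bar R})).
exact: measurable_tuple_cons.
Qed.

HB.instance Definition _ := isMeasure.Build _ _ _ cons_measure
  cons_measure0 cons_measure_ge0 cons_measure_sigma_additive.

Let cons_measure_sigma_finite : sigma_finite setT cons_measure.
Proof.
have /sigma_finiteP[F [FT ndF Foo]] := sigma_finiteT (@lebesgue_measure R).
have /sigma_finiteP[G [GT ndG Goo]] := sigma_finiteT m.
exists (fun k => tuple_uncons @^-1` (F k `*` G k)).
  apply/esym; rewrite -subTset => v _.
  have [i _ Fi] : (\bigcup_i F i) (tuple_uncons v).1 by rewrite -FT.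
  have [j _ Gj] : (\bigcup_i G i) (tuple_uncons v).2 by rewrite -GT.
  exists (maxn i j) => //; split.
    by move: Fi; exact/subsetPset/ndF/leq_maxl.
  by move: Gj; exact/subsetPset/ndG/leq_maxr.
move=> k; have [mF Fk] := Foo k; have [mG Gk] := Goo k; split.
  rewrite -[X in measurable X]setTI.
  by apply: measurable_tuple_uncons => //; exact: measurableX.
rewrite /cons_measure /pushforward -comp_preimage.
rewrite (_ : _ \o _ = id) ?preimage_id; last first.
  by apply/funext => p; exact: tuple_consK.
by rewrite product_measure1E// lte_mul_pinfty// ge0_fin_numE.
Qed.

HB.instance Definition _ := Measure_isSigmaFinite.Build _ _ _ cons_measure
  cons_measure_sigma_finite.

End cons_measure.

(* Lebesgue measure on R^n, modelled as n-tuples with the product sigma-algebra. *)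
Fixpoint lebesgue_tuple {R : realType} (n : nat) :
    {sigma_finite_measure set (n.-tuple R) -> \bar R} :=
  if n is k.+1 then cons_measure (lebesgue_tuple k)
  else dirac ([tuple] : 0.-tuple R).

(* The measure of a box; this determines [lebesgue_tuple n] uniquely. *)
Lemma lebesgue_tuple_box {R : realType} (n : nat) (A : 'I_n -> set R) :
  (forall i, measurable (A i)) ->
  lebesgue_tuple n [set v | forall i, A i (tnth v i)] =
  (\prod_(i < n) @lebesgue_measure R (A i))%E.
Proof.
elim: n A => [|n IH] A mA /=.
  by rewrite big_ord0 diracE mem_set// => -[].
rewrite big_ord_recl -(IH (fun i => A (lift ord0 i)))//.
rewrite /cons_measure /pushforward.
rewrite -product_measure1E//=.
  congr (_ _); apply/seteqP; split => -[a v] /=.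
    move=> H; split; first by have := H ord0; rewrite tnth0.
    by move=> i; have := H (lift ord0 i); rewrite tnthS.
  move=> [H0 H] i; case: (unliftP ord0 i) => [j ->|->]; last by rewrite tnth0.
  by rewrite tnthS.
  exact: mA.
rewrite [X in measurable X](_ : _ =
    \bigcap_(i in [set: 'I_n]) ((fun v : n.-tuple R => tnth v i) @^-1` A (lift ord0 i))).
  apply: fin_bigcap_measurable => // i _; rewrite -[X in measurable X]setTI.
  exact: measurable_tnth.
by apply/seteqP; split => v /= H i; [move=> _|]; exact: H.
Qed.

Section complex_functions.
Context {R : realType}.
Local Open Scope complex_scope.

Definition expc (z : R[i]) : R[i] :=
  (expR (complex.Re z))%:C * (cos (complex.Im z) +i* sin (complex.Im z)).

(* r ^ z = e ^ (z ln r) for r > 0; for r <= 0, [ln r = 0] and the value is 1.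
   In [wave_kernel] this only affects the null set {0}. *)
Definition cpow (r : R) (z : R[i]) : R[i] := expc ((ln r)%:C * z).

(* Meaningful when the real and imaginary parts are integrable; [Rintegral] is
   total. The integrand of [wave_kernel] is absolutely integrable if d >= 2. *)
Definition cintegral d (T : measurableType d) (mu : {measure set T -> \bar R})
    (f : T -> R[i]) : R[i] :=
  (\int[mu]_x complex.Re (f x)) +i* (\int[mu]_x complex.Im (f x)).

Definition smooth (f : R -> R) : Prop :=
  forall (k : nat) (x : R), derivable (derive1n k f) x 1.

(* C_c^oo(U) with complex values, functions being extended by 0 to R. *)
Definition test_function (U : set R) (f : R -> R[i]) : Prop :=
  [/\ smooth (fun x => complex.Re (f x)), smooth (fun x => complex.Im (f x)),
      compact (closure [set x | f x != 0]) &
      closure [set x | f x != 0] `<=` U].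

End complex_functions.

Section wave.
Context {R : realType} {d : nat}.
Local Open Scope complex_scope.

Definition dot (x y : d.-tuple R) : R := \sum_(i < d) tnth x i * tnth y i.

Definition enorm (x : d.-tuple R) : R := Num.sqrt (dot x x).

Definition wave_kernel (chi : R -> R[i]) (kappa : R) (x : d.-tuple R) (t : R) :
    R[i] :=
  cintegral (lebesgue_tuple d) (fun xi =>
    expc (0 +i* (dot x xi + t * enorm xi)) *
    cpow (enorm xi) (- ((d%:R + 1) / 2) +i* kappa) *
    chi (enorm xi)).

End wave.

(* Main.v *)
Require Import Defs.
From HB Require Import structures.
From mathcomp Require Import all_boot all_order all_algebra.
From mathcomp Require Import all_classical all_reals all_analysis.
From mathcomp Require Import measurable_realfun complex ring lra.
Set Implicit Arguments.
Unset Strict Implicit.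
Unset Printing Implicit Defensive.
Import Order.TTheory GRing.Theory Num.Theory.
Import numFieldNormedType.Exports.
Local Open Scope classical_set_scope.
Local Open Scope ring_scope.

(** Write m = (d - 1) / 2. Taking real and imaginary parts of the kernel and of
    the cut-off, and turning sines into cosines by a phase shift, leaves four
    real integrals [wave_part] with integrand
      |xi|^(-(d+1)/2) cos(x.xi + t|xi| + kappa ln|xi| + al) psi(|xi|),
    where psi is smooth, vanishes on a neighbourhood of [1, +oo[, and the
    constant phase al is arbitrary. In polar coordinates such an integral is
    d times the integral over 0 < r <= 1 and over eta in the unit ball of
      r^(m-1) psi(r) cos(r (x.w + t) + kappa ln r + al),   w = eta / |eta|.

    Suppose first |x| <= |t| / 2. Then |x.w + t| >= |t| / 2 for every direction
    w, so the phase has no stationary point in r, and enough integrations by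
    parts in r, started at r = 1 / |x.w + t|, give the decay |t|^(-m)
    ([osc_symbol_decay]).

    Suppose now |x| > |t| / 2. Integrate over directions first: this replaces
    the cosine by cos(rt + kappa ln r + al) B(r|x|), where B, the Fourier
    transform of the sphere, solves B'' + (2m/s) B' + B = 0
    ([sphere_ft_bessel]). An energy estimate for this equation gives
    s^m B(s) = p(s) sin s + q(s) cos s with p, q bounded and p', q' = O(s^(-2))
    for s >= 1 ([bessel_amplitude]); no finer asymptotics of Bessel functions
    are involved. The part r < 1/|x| is trivially O(|x|^(-m)), and the rest is
    |x|^(-m) times integrals of r^(-1) cos(r l + kappa ln r + al') h(r), with
    l = t + |x| or t - |x| and h of bounded variation uniformly in x. When l = 0
    only the oscillation of r^(i kappa) keeps these from diverging
    logarithmically, so that they are of size 1/kappa: this is where the factor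
    kappa is needed. Since
      kappa r^(-1) cos(phase) = (sin(phase))' - l cos(phase),
    kappa times the integral is bounded for r <= 1/|l|, and beyond 1/|l| the
    frequency l gives convergence ([osc_log]). Hence a bound by |x|^(-m), which
    is at most a constant times |t|^(-m).

    Both geometric inputs come from Tonelli's theorem and one-dimensional affine
    substitutions. Polar coordinates ([ge0_integral_polar]) follow from
    homogeneity under dilations alone, with the unit ball in the role of the
    sphere. Bessel's equation follows from rotation invariance: the integral of
    cos(s a.w) does not change when the unit vector a turns, and its second
    derivative along the rotation is the equation ([sphere_tangential]). *)

(** * Rules for computing derivatives *)

Section derive_rules.
Context {R : realType}.
Implicit Types (f g : R -> R) (x a df dg : R).

Lemma der_eq f x df dg : is_derive x 1 f df -> df = dg -> is_derive x 1 f dg.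
Proof. by move=> H <-. Qed.

Lemma der_cst a x : is_derive x 1 (fun=> a) 0.
Proof. exact: is_derive_cst. Qed.

Lemma der_id x : is_derive x 1 (fun y : R => y) 1.
Proof. exact: is_derive_id. Qed.

Lemma der_add f g x df dg : is_derive x 1 f df -> is_derive x 1 g dg ->
  is_derive x 1 (fun y => f y + g y) (df + dg).
Proof. by move=> ? ?; exact: is_deriveD. Qed.

Lemma der_opp f x df : is_derive x 1 f df -> is_derive x 1 (fun y => - f y) (- df).
Proof. by move=> ?; exact: is_deriveN. Qed.

Lemma der_mul f g x df dg : is_derive x 1 f df -> is_derive x 1 g dg ->
  is_derive x 1 (fun y => f y * g y) (df * g x + f x * dg).
Proof.
move=> df' dg'; apply: (der_eq (is_deriveM df' dg')).
by rewrite /GRing.scale/= addrC mulrC.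
Qed.

Lemma der_exp f n x df : is_derive x 1 f df ->
  is_derive x 1 (fun y => f y ^+ n.+1) (n.+1%:R * f x ^+ n * df).
Proof.
move=> df'; rewrite (_ : (fun y => _) = f ^+ n.+1); last first.
  by apply/funext => y; rewrite fctE.
apply: (der_eq (is_deriveX n.+1 df')).
by rewrite /GRing.scale/= mulr_natl.
Qed.

Lemma der_comp f g x df dg : is_derive (g x) 1 f df -> is_derive x 1 g dg ->
  is_derive x 1 (fun y => f (g y)) (df * dg).
Proof. by move=> df' dg'; exact: (is_derive1_comp df' dg'). Qed.

Lemma der_inv f x df : f x != 0 -> is_derive x 1 f df ->
  is_derive x 1 (fun y => (f y)^-1) (- (df / f x ^+ 2)).
Proof.
move=> f0 df'; apply: (der_eq (is_deriveV f0 df')).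
by rewrite /GRing.scale/= mulNr mulrC.
Qed.

Lemma der_cos f x df : is_derive x 1 f df ->
  is_derive x 1 (fun y => cos (f y)) (- sin (f x) * df).
Proof. by move=> ?; apply: der_comp. Qed.

Lemma der_sin f x df : is_derive x 1 f df ->
  is_derive x 1 (fun y => sin (f y)) (cos (f x) * df).
Proof. by move=> ?; apply: der_comp. Qed.

Lemma der_expR f x df : is_derive x 1 f df ->
  is_derive x 1 (fun y => expR (f y)) (expR (f x) * df).
Proof. by move=> ?; apply: der_comp. Qed.

Lemma der_ln f x df : 0 < f x -> is_derive x 1 f df ->
  is_derive x 1 (fun y => ln (f y)) ((f x)^-1 * df).
Proof. by move=> f0 df'; exact: (der_comp (is_derive1_ln f0) df'). Qed.

Lemma der_powR f a x df : 0 < f x -> is_derive x 1 f df ->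
  is_derive x 1 (fun y => f y `^ a) (a * f x `^ (a - 1) * df).
Proof. by move=> f0 df'; exact: (der_comp (is_derive1_powR a f0) df'). Qed.

Lemma der_continuous f x df : is_derive x 1 f df -> {for x, continuous f}.
Proof.
by move=> H; apply/differentiable_continuous/derivable1_diffP/ex_derive.
Qed.

Lemma der_derivable f x df : is_derive x 1 f df -> derivable f x 1.
Proof. by case. Qed.

End derive_rules.

(** Solves [is_derive x 1 f ?df] by following the syntax of [f]; what remains is
    the positivity and nonvanishing of arguments of [ln], [powR] and inverses.
    To be used below [der_eq], which compares the derivative found with the
    expected one. Powers are tried before products, since [f ^+ 2] also unifies
    with a product. *)
Ltac der :=
  repeat first
    [ eassumption | eapply der_cst | eapply der_id | eapply der_add
    | eapply der_opp | eapply der_exp | eapply der_mul | eapply der_inv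
    | eapply der_cos | eapply der_sin | eapply der_expR | eapply der_ln
    | eapply der_powR ].

(** * Affine substitutions and dilations *)

Section line.
Context {R : realType}.
Local Notation mu := (@lebesgue_measure R).
Local Open Scope ereal_scope.

(** The image of Lebesgue measure under x |-> a x + b, multiplied by a, agrees
    with Lebesgue measure on half-open intervals, hence everywhere. *)
Lemma ge0_integral_affine (a b : R) (f : R -> \bar R) : (0 < a)%R ->
  measurable_fun [set: R] f -> (forall x, 0 <= f x) ->
  \int[mu]_x f (a * x + b)%R = (a^-1)%:E * \int[mu]_x f x.
Proof.
move=> a0 mf f0.
pose phi := (fun x => a * x + b)%R : measurableTypeR R -> measurableTypeR R.
have mphi : measurable_fun [set: measurableTypeR R] phi.
  by apply: measurable_funD => //; exact: measurable_funM.
have ai0 : (0 <= a)%R by exact: ltW.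
pose push : {measure set (measurableTypeR R) -> \bar R} := pushforward mu phi.
pose nu : {measure set (measurableTypeR R) -> \bar R} :=
  mscale (NngNum ai0) (push mphi).
have nuE A : measurable A -> mu A = nu A.
  apply: lebesgue_measure_unique => _ [[u v]] _ <-.
  rewrite /nu /mscale /pushforward /=.
  have phiE : phi @^-1` `]u, v] = `](a^-1 * (u - b))%R, (a^-1 * (v - b))%R]%classic.
    apply/seteqP; split => x /=; rewrite !in_itv/= /phi !ltr_pdivrMl// !ler_pdivlMl//;
    by rewrite ltrBlDr lerBrDr.
  rewrite [X in _ = _ * mu X]phiE.
  rewrite [LHS]lebesgue_measure_itv/= [X in _ * X]lebesgue_measure_itv/= !lte_fin.
  rewrite ltr_pM2l ?invr_gt0// ltrD2r; case: ifP => _; last by rewrite mule0.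
  rewrite -!EFinB -EFinM; congr (_%:E).
  by field; rewrite gt_eqF.
transitivity ((a^-1)%:E * \int[nu]_x f x); last first.
  congr (_ * _); apply: eq_measure_integral => A mA _; exact/esym/nuE.
rewrite /nu ge0_integral_mscale//= muleA -EFinM mulVf ?gt_eqF// mul1e.
by rewrite ge0_integral_pushforward//.
Qed.

Lemma ge0_integral_oppr (f : R -> \bar R) :
  measurable_fun [set: R] f -> (forall x, 0 <= f x) ->
  \int[mu]_x f (- x)%R = \int[mu]_x f x.
Proof.
move=> mf f0.
transitivity (\int[pushforward mu (-%R : _ -> measurableTypeR R)]_x f x).
  by rewrite ge0_integral_pushforward.
by apply: eq_measure_integral => A mA _; exact: lebesgue_measureN.
Qed.

End line.

Section tuples.
Context {R : realType}.
Local Notation mu := (@lebesgue_measure R).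
Local Notation leb := (@lebesgue_tuple R).
Implicit Types n : nat.

Definition scale_tuple n (c : R) (v : n.-tuple R) : n.-tuple R :=
  map_tuple ( *%R c) v.

Lemma dot_cons n (a b : R) (u v : n.-tuple R) :
  dot (tuple_cons (a, u)) (tuple_cons (b, v)) = a * b + dot u v.
Proof.
rewrite /dot big_ord_recl /= !tnth0; congr (_ + _).
by apply: eq_bigr => i _; rewrite !tnthS.
Qed.

Lemma tuple_consP n (v : n.+1.-tuple R) : exists p, v = tuple_cons p.
Proof. by exists (tuple_uncons v); rewrite tuple_unconsK. Qed.

Lemma scale_cons n c (p : R * n.-tuple R) :
  scale_tuple c (tuple_cons p) = tuple_cons (c * p.1, scale_tuple c p.2).
Proof. exact/val_inj. Qed.

Lemma dot_scaler n c (x v : n.-tuple R) : dot x (scale_tuple c v) = c * dot x v.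
Proof.
rewrite /dot mulr_sumr; apply: eq_bigr => i _.
by rewrite tnth_map mulrCA.
Qed.

Lemma dot_scalel n c (x v : n.-tuple R) : dot (scale_tuple c x) v = c * dot x v.
Proof.
rewrite /dot mulr_sumr; apply: eq_bigr => i _.
by rewrite tnth_map mulrA.
Qed.

Lemma dot_ge0 n (x : n.-tuple R) : 0 <= dot x x.
Proof. by apply: sumr_ge0 => i _; rewrite -expr2 sqr_ge0. Qed.

Lemma enorm_ge0 n (x : n.-tuple R) : 0 <= enorm x.
Proof. exact: sqrtr_ge0. Qed.

Lemma enorm_scale n c (x : n.-tuple R) : 0 <= c ->
  enorm (scale_tuple c x) = c * enorm x.
Proof.
move=> c0; rewrite /enorm dot_scaler dot_scalel mulrA -expr2 sqrtrM ?sqr_ge0//.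
by rewrite sqrtr_sqr ger0_norm.
Qed.

Lemma measurable_scale d (T : measurableType d) n (c : T -> R) (g : T -> n.-tuple R) :
  measurable_fun setT c -> measurable_fun setT g ->
  measurable_fun setT (fun x => scale_tuple (c x) (g x)).
Proof.
move=> mc mg; apply/measurable_fun_tnthP => i.
rewrite (_ : _ \o _ = fun x => c x * tnth (g x) i); last first.
  by apply/funext => x /=; rewrite tnth_map.
apply: measurable_funM => //.
apply: (measurableT_comp (measurable_tnth i)) => //.
Qed.

Lemma measurable_dot n (x : n.-tuple R) : measurable_fun setT (dot x).
Proof.
apply: measurable_sum => i; apply: measurable_funM => //; exact: measurable_tnth.
Qed.

Lemma measurable_dotxx n : measurable_fun setT (fun v : n.-tuple R => dot v v).
Proof.
by apply: measurable_sum => i; apply: measurable_funM; exact: measurable_tnth.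
Qed.

Lemma measurable_sqrtr : measurable_fun setT (@Num.sqrt R).
Proof. by apply: continuous_measurable_fun; exact: sqrt_continuous. Qed.

Lemma measurable_enorm n : measurable_fun setT (@enorm R n).
Proof. exact: (measurableT_comp measurable_sqrtr (@measurable_dotxx n)). Qed.

Local Open Scope ereal_scope.

Lemma ge0_integral_tupleS n (f : n.+1.-tuple R -> \bar R) :
  measurable_fun setT f -> (forall x, 0 <= f x) ->
  \int[leb n.+1]_v f v = \int[mu]_a \int[leb n]_v f (tuple_cons (a, v)).
Proof.
move=> mf f0.
transitivity (\int[(mu \x leb n)%E]_p f (tuple_cons p)).
  have := @ge0_integral_pushforward _ _ (measurableTypeR R * n.-tuple R)%type _ _ _
     (@measurable_tuple_cons R n) (mu \x leb n)%E setT f measurableT mf.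
  by rewrite preimage_setT; exact.
rewrite fubini_tonelli1//.
exact: (measurableT_comp mf (@measurable_tuple_cons R n)).
Qed.

Lemma ge0_integral_tuple0 (f : 0.-tuple R -> \bar R) :
  measurable_fun setT f ->
  \int[leb 0]_v f v = f [tuple].
Proof. by move=> mf; rewrite integral_dirac// diracT mul1e. Qed.

Lemma ge0_integral_scale n (c : R) (f : n.-tuple R -> \bar R) : (0 < c)%R ->
  measurable_fun setT f -> (forall x, 0 <= f x) ->
  \int[leb n]_v f (scale_tuple c v) = (c^-1 ^+ n)%:E * \int[leb n]_v f v.
Proof.
move=> c0; elim: n f => [|n IH] f mf f0.
  rewrite !ge0_integral_tuple0//.
    by rewrite mul1e; congr f; exact/val_inj.
  apply: (measurableT_comp mf); exact: measurable_scale.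
have mfs : measurable_fun setT (fun p => f (tuple_cons (p : R * n.-tuple R))).
  exact: (measurableT_comp mf (@measurable_tuple_cons R n)).
rewrite !ge0_integral_tupleS//; last first.
  by apply: (measurableT_comp mf); exact: measurable_scale.
transitivity (\int[mu]_a ((c^-1 ^+ n)%:E *
    \int[leb n]_v f (tuple_cons ((c * a)%R, v)))).
  apply: eq_integral => a _; rewrite -IH//.
    by apply: eq_integral => v _; rewrite scale_cons.
  apply: (measurableT_comp mf).
  apply: (measurableT_comp (@measurable_tuple_cons R n)).
  exact: measurable_fun_pair.
rewrite ge0_integralZl//; last 3 first.
- apply: (measurableT_comp (measurable_fun_fubini_tonelli_F (m2 := leb n)
    (fun p => f (tuple_cons p)) mfs _)) => //.
- by move=> a _; apply: integral_ge0.
- by rewrite lee_fin exprn_ge0// invr_ge0 ltW.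
pose h a := \int[leb n]_v f (tuple_cons (a, v)).
have -> : \int[mu]_a h (c * a)%R = \int[mu]_a h (c * a + 0)%R.
  by apply: eq_integral => a _; rewrite addr0.
rewrite ge0_integral_affine//; last 2 first.
- exact: (measurable_fun_fubini_tonelli_F (m2 := leb n)
    (fun p => f (tuple_cons p)) mfs _).
- by move=> a; apply: integral_ge0.
by rewrite muleA -EFinM exprSr.
Qed.

End tuples.

(** * Rotation invariance of Lebesgue measure *)

Section rotation.
Context {R : realType}.
Local Notation mu := (@lebesgue_measure R).
Local Notation leb := (@lebesgue_tuple R).
Local Open Scope ereal_scope.

Lemma measurable_curry2 d (T : measurableType d) (H : R -> R -> \bar R)
    (f g : T -> R) : measurable_fun setT (fun p : R * R => H p.1 p.2) ->
  measurable_fun setT f -> measurable_fun setT g ->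
  measurable_fun setT (fun x => H (f x) (g x)).
Proof.
move=> mH mf mg.
exact: (measurableT_comp mH (measurable_fun_pair mf mg)).
Qed.

(** With c = x / rho and s = y / rho, the orthogonal change of variables
    u = c a + s b, v = s a - c b splits into two affine substitutions in one
    variable: b is exchanged for u at fixed a (factor 1 / s), then a for v at
    fixed u (factor s). This needs s > 0, whence the case y = 0 apart. *)
Lemma ge0_integral_rotation2 (H : R -> R -> \bar R) (x y : R) : (0 <= y)%R ->
  measurable_fun setT (fun p : R * R => H p.1 p.2) ->
  (forall a b, 0 <= H a b) ->
  \int[mu]_a \int[mu]_b H (x * a + y * b)%R (a ^+ 2 + b ^+ 2)%R =
  \int[mu]_a \int[mu]_b H (Num.sqrt (x ^+ 2 + y ^+ 2) * a)%R (a ^+ 2 + b ^+ 2)%R.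
Proof.
move=> + mH H0; rewrite le_eqVlt => /predU1P[<-|y0].
  rewrite expr0n addr0 sqrtr_sqr.
  pose G a := \int[mu]_b H (`|x| * a)%R (a ^+ 2 + b ^+ 2)%R.
  have mG : measurable_fun [set: R] G.
    apply: (measurable_fun_fubini_tonelli_F (m2 := mu)
      (fun p : R * R => H (`|x| * p.1)%R (p.1 ^+ 2 + p.2 ^+ 2)%R)) => //.
    apply: measurable_curry2 => //; first exact: measurable_funM.
    by apply: measurable_funD; exact: measurable_funX.
  have G0 a : 0 <= G a by apply: integral_ge0.
  have [x0|x0] := leP 0%R x.
    apply: eq_integral => a _; apply: eq_integral => b _.
    by rewrite mul0r addr0 ger0_norm.
  rewrite -(ge0_integral_oppr mG)//.
  apply: eq_integral => a _; apply: eq_integral => b _.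
  by rewrite mul0r addr0 ltr0_norm// mulrNN sqrrN.
set rho := Num.sqrt _.
have rho2 : (rho ^+ 2 = x ^+ 2 + y ^+ 2)%R.
  by rewrite sqr_sqrtr// addr_ge0// sqr_ge0.
have rho0 : (0 < rho)%R.
  by rewrite sqrtr_gt0 ltr_wpDl ?sqr_ge0// exprn_gt0.
pose c := (x / rho)%R; pose s := (y / rho)%R.
have s0 : (0 < s)%R by rewrite divr_gt0.
have xE : (x = rho * c)%R by rewrite /c mulrC divfK// gt_eqF.
have yE : (y = rho * s)%R by rewrite /s mulrC divfK// gt_eqF.
have cs1 : (c ^+ 2 + s ^+ 2 = 1)%R.
  by rewrite /c /s !expr_div_n -mulrDl -rho2 divff// gt_eqF// exprn_gt0.
pose K (u a : R) := H (rho * u)%R (a ^+ 2 + ((u - c * a) / s) ^+ 2)%R.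
have mK : measurable_fun setT (fun p : R * R => K p.2 p.1).
  apply: (measurable_curry2 mH); first by apply: measurable_funM.
  apply: measurable_funD; first exact: measurable_funX.
  apply: measurable_funX; apply: measurable_funM => //.
  by apply: measurable_funB => //; exact: measurable_funM.
transitivity (\int[mu]_a ((s^-1)%:E * \int[mu]_u K u a)).
  apply: eq_integral => a _.
  rewrite -(@ge0_integral_affine R s (c * a)%R (fun u => K u a))//.
  - apply: eq_integral => b _; rewrite /K addrK.
    have -> : (s * b / s = b)%R by rewrite mulrAC divff ?mul1r// gt_eqF.
    by congr H; rewrite xE yE; ring.
  - exact: (measurableT_comp mK (measurable_pair1 a)).
  - by move=> u; exact: H0.
rewrite ge0_integralZl//; last 3 first.
- exact: (measurable_fun_fubini_tonelli_F (m2 := mu) (fun p => K p.2 p.1)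
    mK (fun p => H0 _ _)).
- by move=> a _; apply: integral_ge0 => u _; exact: H0.
- by rewrite lee_fin invr_ge0 ltW.
have -> : \int[mu]_a \int[mu]_u K u a = \int[mu]_u \int[mu]_a K u a.
  exact: (@fubini_tonelli _ _ (measurableTypeR R) (measurableTypeR R) _ mu mu
    (fun p => K p.2 p.1) mK (fun p => H0 _ _)).
rewrite -ge0_integralZl//; last 3 first.
- exact: (measurable_fun_fubini_tonelli_G (m1 := mu) (fun p => K p.2 p.1)
    mK (fun p => H0 _ _)).
- by move=> a _; apply: integral_ge0 => u _; exact: H0.
- by rewrite lee_fin invr_ge0 ltW.
apply: eq_integral => u _.
pose k v := H (rho * u)%R (u ^+ 2 + v ^+ 2)%R.
have mk : measurable_fun [set: R] k.
  apply: measurable_curry2 => //; apply: measurable_funD => //.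
have -> : \int[mu]_a K u a = \int[mu]_a k (s^-1 * a + - c / s * u)%R.
  apply: eq_integral => a _; rewrite /K /k; congr H.
  have : (c ^+ 2 = 1 - s ^+ 2)%R by rewrite -cs1 addrK.
  have sn0 : s != 0%R by rewrite gt_eqF.
  move=> c2; apply/(mulfI (expf_neq0 2 sn0)).
  transitivity (s ^+ 2 * a ^+ 2 + u ^+ 2 - c * a * u *+ 2 + c ^+ 2 * a ^+ 2)%R.
    by field.
  rewrite c2.
  transitivity (s ^+ 2 * u ^+ 2 + a ^+ 2 - c * a * u *+ 2 + c ^+ 2 * u ^+ 2)%R.
    by rewrite c2; ring.
  by field.
rewrite (@ge0_integral_affine R s^-1 (- c / s * u)%R k) ?invr_gt0//; last first.
  by move=> v; exact: H0.
rewrite invrK muleA -EFinM mulVf ?gt_eqF//.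
by rewrite mul1e.
Qed.

(** By induction on the dimension the tail x' of x can be turned onto the first
    axis of its space; what remains is a rotation in the plane of the first two
    coordinates, the others being parameters. *)
Lemma ge0_integral_rotation n (F : R -> R -> \bar R) (x : n.+1.-tuple R) :
  measurable_fun setT (fun p : R * R => F p.1 p.2) ->
  (forall a b, 0 <= F a b) ->
  \int[leb n.+1]_v F (dot x v) (dot v v) =
  \int[mu]_a \int[leb n]_u F (enorm x * a)%R (a ^+ 2 + dot u u)%R.
Proof.
elim: n F x => [|n IH] F x mF F0.
  rewrite ge0_integral_tupleS//; last first.
    apply: measurable_curry2 => //; first exact: measurable_dot.
    exact: measurable_dotxx.
  have [[x1 x'] ->] := tuple_consP x.
  have E0 (u v : 0.-tuple R) : dot u v = 0%R by rewrite /dot big_ord0.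
  transitivity (\int[mu]_a F (x1 * a)%R (a ^+ 2)%R).
    apply: eq_integral => a _; rewrite ge0_integral_tuple0; last first.
      apply: measurable_curry2 => //.
        apply: (measurableT_comp (measurable_dot _)).
        exact: (measurableT_comp (@measurable_tuple_cons R 0) (measurable_pair1 a)).
      apply: (measurableT_comp (@measurable_dotxx R _)).
      exact: (measurableT_comp (@measurable_tuple_cons R 0) (measurable_pair1 a)).
    by rewrite !dot_cons !E0 !addr0.
  transitivity (\int[mu]_a F (`|x1| * a)%R (a ^+ 2)%R); last first.
    apply: eq_integral => a _; rewrite ge0_integral_tuple0; last first.
      apply: measurable_curry2 => //.
      by apply: measurable_funD => //; exact: measurable_dotxx.
    by rewrite E0 addr0 /enorm dot_cons E0 addr0 -expr2 sqrtr_sqr.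
  have [x0|x0] := leP 0%R x1; first by rewrite ger0_norm.
  rewrite -[RHS]ge0_integral_oppr//.
    by apply: eq_integral => a _; rewrite ltr0_norm// mulrNN sqrrN.
  by apply: (measurable_curry2 mF).

have [[x1 x'] ->] := tuple_consP x.
rewrite ge0_integral_tupleS//; last first.
  by apply: measurable_curry2 => //; [exact: measurable_dot|exact: measurable_dotxx].
pose H (p q : R) := \int[leb n]_u F p (q + dot u u)%R.
have mH : measurable_fun setT (fun p : R * R => H p.1 p.2).
  apply: (measurable_fun_fubini_tonelli_F (m2 := leb n)
    (fun p : (R * R) * n.-tuple R => F p.1.1 (p.1.2 + dot p.2 p.2)%R)) => //.
  apply: measurable_curry2 => //; first exact: measurableT_comp.
  apply: measurable_funD; first exact: measurableT_comp.
  exact: (measurableT_comp (@measurable_dotxx R n)).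
have H0 a b : 0 <= H a b by apply: integral_ge0.
transitivity (\int[mu]_a \int[mu]_b H (x1 * a + enorm x' * b)%R (a ^+ 2 + b ^+ 2)%R).
  apply: eq_integral => a _.
  transitivity (\int[leb n.+1]_v F (x1 * a + dot x' v)%R (a ^+ 2 + dot v v)%R).
    by apply: eq_integral => v _; rewrite !dot_cons.
  rewrite (IH (fun p q => F (x1 * a + p)%R (a ^+ 2 + q)%R))//; last first.
    by apply: measurable_curry2 => //; exact: measurable_funD.
  apply: eq_integral => b _; apply: eq_integral => u _.
  by rewrite addrA.
rewrite ge0_integral_rotation2 ?enorm_ge0//.
apply: eq_integral => a _.
rewrite ge0_integral_tupleS//; last first.
  apply: measurable_curry2 => //.
  by apply: measurable_funD => //; exact: measurable_dotxx.
apply: eq_integral => b _; apply: eq_integral => u _.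
by rewrite dot_cons addrA /enorm dot_cons -[in RHS]expr2 sqr_sqrtr ?dot_ge0// -expr2.
Qed.

Lemma ge0_integral_rotationE n (F : R -> R -> \bar R) (x y : n.-tuple R) :
  measurable_fun setT (fun p : R * R => F p.1 p.2) ->
  (forall a b, 0 <= F a b) -> enorm x = enorm y ->
  \int[leb n]_v F (dot x v) (dot v v) = \int[leb n]_v F (dot y v) (dot v v).
Proof.
case: n x y => [|n] x y mF F0 xy; first by rewrite (tuple0 x) (tuple0 y).
by rewrite (ge0_integral_rotation x mF F0) (ge0_integral_rotation y mF F0) xy.
Qed.

End rotation.

(** * Polar coordinates *)

Section polar.
Context {R : realType}.
Local Notation mu := (@lebesgue_measure R).
Local Notation leb := (@lebesgue_tuple R).

Lemma measurable_invr : measurable_fun [set: R] (@GRing.inv R).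
Proof.
(* also valid at 0, where the inverse is 0 *)
rewrite (_ : @GRing.inv R = fun s => s * (`|s| `^ (-1)) ^+ 2); last first.
  apply/funext => s; rewrite powR_inv1//.
  have [->|s0] := eqVneq s 0; first by rewrite mul0r invr0.
  by rewrite exprVn real_normK ?num_real// expr2 invfM mulrA divff// mul1r.
apply: measurable_funM => //; apply: measurable_funX.
by apply: (measurableT_comp (measurable_powR _)).
Qed.

(** The origin is removed because it has no direction. *)
Definition punctured_ball n : set (n.-tuple R) := [set v | 0 < enorm v <= 1].

Lemma measurable_punctured_ball n : measurable (@punctured_ball n).
Proof.
rewrite (_ : @punctured_ball n = setT `&` (@enorm R n) @^-1` `]0, 1]%classic).
  by apply: measurable_enorm.
by rewrite setTI; apply/seteqP; split => v; rewrite /punctured_ball /= in_itv.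
Qed.

Definition direction n (v : n.-tuple R) := scale_tuple (enorm v)^-1 v.

Lemma measurable_direction n : measurable_fun setT (@direction n).
Proof.
apply: measurable_scale => //.
exact: (measurableT_comp measurable_invr (@measurable_enorm R n)).
Qed.

Lemma scale_tupleA n (a b : R) (v : n.-tuple R) :
  scale_tuple a (scale_tuple b v) = scale_tuple (a * b) v.
Proof. by apply: eq_from_tnth => i; rewrite !tnth_map mulrA. Qed.

Lemma scale_tuple1 n (v : n.-tuple R) : scale_tuple 1 v = v.
Proof. by apply: eq_from_tnth => i; rewrite !tnth_map mul1r. Qed.

Definition pos_line : set R := `]0, +oo[%classic.

Lemma measurable_pos_line : measurable pos_line.
Proof. by rewrite /pos_line; exact: measurable_itv. Qed.

Lemma measurable_box n (A : set R) : measurable A ->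
  measurable [set v : n.-tuple R | forall i, A (tnth v i)].
Proof.
move=> mA.
rewrite [X in measurable X](_ : _ =
    \bigcap_(i in [set: 'I_n]) ((fun v : n.-tuple R => tnth v i) @^-1` A)).
  apply: fin_bigcap_measurable => // i _; rewrite -[X in measurable X]setTI.
  exact: measurable_tnth.
by apply/seteqP; split => v /= H i; [move=> _|]; exact: H.
Qed.

Lemma mem_pos_line s : (s \in pos_line) = (0 < s).
Proof. by apply/idP/idP; rewrite inE /pos_line /= in_itv/= andbT. Qed.

Lemma mem_punctured_ball n (v : n.-tuple R) : (v \in @punctured_ball n) = (0 < enorm v <= 1).
Proof. by apply/idP/idP; rewrite inE. Qed.

(** The ball lies in a cube, whose measure is a finite product. *)
Lemma lebesgue_tuple_punctured_ball_lty n : (leb n (@punctured_ball n) < +oo)%E.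
Proof.
apply: (@le_lt_trans _ _
  (leb n [set v | forall i, `[-1, 1]%classic (tnth v i)])); last first.
  rewrite (lebesgue_tuple_box (A := fun=> `[-1, 1]%classic))//.
  rewrite big_const_ord lebesgue_measure_itv/= lte_fin gtrN// -EFinB.
  elim: n => [|n IH] /=; first by rewrite ltry.
  by apply: lte_mul_pinfty.
apply: le_measure; rewrite ?inE.
- exact: measurable_punctured_ball.
- exact: measurable_box.
move=> v /andP[_ v1] i /=; rewrite in_itv/= -ler_norml.
apply: le_trans v1; rewrite -sqrtr_sqr ler_sqrt ?dot_ge0// /dot (bigD1 i)//=.
by rewrite -expr2 lerDl sumr_ge0// => j _; rewrite -expr2 sqr_ge0.
Qed.

Lemma lebesgue_tuple_enorm0 n : leb n.+1 [set v | enorm v = 0] = 0%E.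
Proof.
apply/eqP; rewrite eq_le measure_ge0 andbT.
apply: (@le_trans _ _ (leb n.+1 [set v | forall i, [set 0] (tnth v i)])); last first.
  rewrite (lebesgue_tuple_box (A := fun=> [set 0]))// big_ord_recl [X in (X * _)%E]lebesgue_measure_set1.
  by rewrite mul0e.
apply: le_measure; rewrite ?inE.
- rewrite (_ : mkset _ = setT `&` (@enorm R n.+1) @^-1` [set 0]); last first.
    by rewrite setTI.
  by apply: measurable_enorm.
- exact: measurable_box.
move=> v /= /eqP; rewrite sqrtr_eq0 => v0 i.
apply/eqP; rewrite -sqrf_eq0 eq_le sqr_ge0 andbT; apply: le_trans v0.
rewrite /dot (bigD1 i)//=.
by rewrite -expr2 lerDl sumr_ge0// => j _; rewrite -expr2 sqr_ge0.
Qed.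

Lemma integral_inv_expr n (a : R) : 0 < a ->
  (\int[mu]_(s in `[a, +oo[) (s^-1 ^+ n.+2)%:E = ((a^-1 ^+ n.+1) / n.+1%:R)%:E)%E.
Proof.
move=> a0.
pose F (s : R) := - (s^-1 ^+ n.+1 / n.+1%:R).
have dF (s : R) : 0 < s -> is_derive s 1 F (s^-1 ^+ n.+2).
  move=> s0.
  rewrite /F; eapply der_eq; first by der; rewrite gt_eqF.
  rewrite /= mulr0 addr0 div1r -exprVn !exprS expr0.
  have nn0 : n.+1%:R != 0 :> R by rewrite pnatr_eq0.
  set u := s^-1; set q := u ^+ n.
  by field.
have ap (x : R) : a <= x -> 0 < x by exact: lt_le_trans.
rewrite (@ge0_continuous_FTC2y _ _ F a 0)//.
- by rewrite /F -EFinB sub0r opprK.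
- by move=> x ax; rewrite exprn_ge0// invr_ge0 ltW// ap.
- apply: derivable_within_continuous => x; rewrite in_itv/= andbT => /ap x0.
  by eapply der_derivable; der; rewrite gt_eqF.
- rewrite /F -oppr0; apply: cvgN; rewrite -(mul0r n.+1%:R^-1); apply: cvgMl.
  rewrite [X in _ --> X](_ : _ = 0 ^+ n.+1); last by rewrite expr0n.
  have V0 : x^-1 @[x --> +oo] --> (0 : R).
    by apply/gtr0_cvgV0 => //; exact: nbhs_pinfty_gt.
  exact: (cvg_comp _ _ V0 (@exprn_continuous R n.+1 0)).
- by move=> x /ltW /ap x0; have [] := dF x x0.
- by apply: cvg_at_right_filter; exact: (der_continuous (dF a a0)).
- move=> x; rewrite in_itv/= andbT => /ltW/ap x0.
  by rewrite derive1E; have [_] := dF x x0.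
Qed.

End polar.

Section polar2.
Context {R : realType}.
Local Notation mu := (@lebesgue_measure R).
Local Notation leb := (@lebesgue_tuple R).
Local Notation L := (measurableTypeR R).
Variable n : nat.
Local Notation T := (n.+1.-tuple R).
Local Notation B0 := (@punctured_ball R n.+1).
Local Notation P0 := (@pos_line R).

(** The image of Lebesgue measure on the ball under [direction] is a multiple of
    surface measure on the sphere; hence the factor n.+1 in the formula of
    [ge0_integral_polar]. *)
Definition polar_weight (p : T * R) : R :=
  \1_B0 p.1 * (\1_P0 p.2 * p.2 ^+ n).

Definition polar_point (p : T * R) : T := scale_tuple p.2 (direction p.1).

Lemma polar_weight_ge0 p : 0 <= polar_weight p.
Proof.
rewrite /polar_weight mulr_ge0// /indic/=.
case: (boolP (p.2 \in P0)) => [|_]; last by rewrite mul0r.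
by rewrite mem_pos_line mul1r => /ltW p0; rewrite exprn_ge0.
Qed.

Lemma measurable_polar_weight :
  measurable_fun [set: T * L] polar_weight.
Proof.
apply: measurable_funM.
  apply: (measurableT_comp (f := \1_B0 : T -> R)) => //.
  by apply: measurable_indic; exact: measurable_punctured_ball.
apply: measurable_funM.
  apply: (measurableT_comp (f := \1_P0 : L -> R)) => //.
  by apply: measurable_indic; exact: measurable_pos_line.
by apply: measurable_funX.
Qed.

Lemma measurable_polar_point : measurable_fun [set: T * L] polar_point.
Proof.
by apply: measurable_scale => //; apply: measurableT_comp => //; exact: measurable_direction.
Qed.

Local Open Scope ereal_scope.

(** Only homogeneity is used. In the double integral over v in the ball and
    r > 0 put r = s |v|, which makes the argument of f equal to s v; exchange
    the integrals and put v = z / s, which makes it z; exchange again. The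
    integral that is left in s, that of s^(-n-2) over s >= |z|, cancels the
    factor |z|^(n+1) up to the constant n+1. *)
Lemma ge0_integral_polar (f : T -> \bar R) :
  measurable_fun setT f -> (forall v, 0 <= f v) ->
  \int[leb n.+1]_v f v = n.+1%:R%:E *
    \int[(leb n.+1 \x mu)%E]_p ((polar_weight p)%:E * f (polar_point p)).
Proof.
move=> mf f0.
have m1 : measurable_fun [set: T * L] (fun p : T * L => p.1) by exact: measurable_fst.
have m2 : measurable_fun [set: T * L] (fun p : T * L => p.2) by exact: measurable_snd.
have mB : measurable_fun setT (\1_B0 : T -> R).
  by apply: measurable_indic; exact: measurable_punctured_ball.
have mP : measurable_fun setT (\1_P0 : L -> R).
  by apply: measurable_indic; exact: measurable_pos_line.
rewrite fubini_tonelli1//=; last 2 first.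
- apply: emeasurable_funM.
    by apply/measurable_EFinP; exact: measurable_polar_weight.
  exact: (measurableT_comp mf measurable_polar_point).
- by move=> p; rewrite mule_ge0// lee_fin polar_weight_ge0.
(* the integrand once r = s |v| *)
pose K (v : T) (s : R) : \bar R :=
  (\1_B0 v * \1_P0 s * s ^+ n * enorm v ^+ n.+1)%:E
    * f (scale_tuple s v).
have K0 v s : 0 <= K v s.
  rewrite mule_ge0// lee_fin mulr_ge0 ?exprn_ge0 ?enorm_ge0//.
  rewrite -mulrA mulr_ge0//.
  rewrite /indic/=; case: (boolP (s \in P0)) => [|_]; last by rewrite mul0r.
  by rewrite mem_pos_line mul1r => /ltW p0; rewrite exprn_ge0.
have mK : measurable_fun [set: T * L] (fun p : T * L => K p.1 p.2).
  apply: emeasurable_funM.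
    apply/measurable_EFinP; apply: measurable_funM.
      apply: measurable_funM; last exact: measurable_funX.
      by apply: measurable_funM; exact: measurableT_comp.
    by apply: measurable_funX; apply: measurableT_comp => //; exact: measurable_enorm.
  by apply: (measurableT_comp mf); exact: measurable_scale.
(* the integrand once moreover v = z / s *)
pose Q (v : T) (s : R) : \bar R :=
  (\1_B0 (scale_tuple s^-1 v) * \1_P0 s
     * enorm v ^+ n.+1 * s^-1 ^+ n.+2)%:E * f v.
have Q0 v s : 0 <= Q v s.
  rewrite mule_ge0// lee_fin.
  rewrite /indic/=; case: (boolP (s \in P0)) => [|_].
    rewrite mem_pos_line => /ltW p0.
    have si : (0 <= s^-1)%R by rewrite invr_ge0.
    apply: mulr_ge0; last exact: exprn_ge0.
    by rewrite mulr_ge0 ?exprn_ge0 ?enorm_ge0.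
  by rewrite mulr0 !mul0r.
have mQ : measurable_fun [set: T * L] (fun p : T * L => Q p.1 p.2).
  have mi : measurable_fun [set: T * L] (fun p => ((p.2 : R)^-1)%R).
    exact: (measurableT_comp measurable_invr).
  apply: emeasurable_funM; last exact: measurableT_comp.
  apply/measurable_EFinP; apply: measurable_funM; last exact: measurable_funX.
  apply: measurable_funM.
    apply: measurable_funM; last exact: measurableT_comp.
    by apply: (measurableT_comp mB); exact: measurable_scale.
  by apply: measurable_funX; apply: measurableT_comp => //; exact: measurable_enorm.
transitivity (n.+1%:R%:E * \int[leb n.+1]_v \int[mu]_s K v s); last first.
  apply: (f_equal (fun y => n.+1%:R%:E * y)).
  apply: eq_integral => v _.
  case: (boolP (v \in B0)) => [|/negbTE vB]; last first.
    rewrite /fubini_F !integral0_eq// => s _.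
      by rewrite /K indicE vB !mul0r mul0e.
    by rewrite /polar_weight/= indicE vB mul0r mul0e.
  move=> /[dup] vB; rewrite mem_punctured_ball => /andP[v0 v1].
  rewrite /fubini_F.
  transitivity (\int[mu]_r ((enorm v)^-1%:E * K v ((enorm v)^-1 * r + 0)%R)).
    rewrite ge0_integralZl//; last 2 first.
    - apply: (measurableT_comp (f := K v)); first exact: (measurableT_comp mK (measurable_pair1 v)).
      by apply: measurable_funD => //; exact: measurable_funM.
    - by rewrite lee_fin invr_ge0 ltW.
    rewrite ge0_integral_affine ?invr_gt0//; last first.
      exact: (measurableT_comp mK (measurable_pair1 v)).
    by rewrite invrK muleA -EFinM mulVf ?gt_eqF// mul1e.
  apply: eq_integral => r _.
  rewrite addr0 /K /polar_weight /polar_point /direction/= scale_tupleA muleA -EFinM.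
  rewrite (mulrC r) indicE vB !mul1r.
  have -> : \1_P0 ((enorm v)^-1 * r)%R = \1_P0 r :> R.
    by rewrite !indicE !mem_pos_line pmulr_rgt0 ?invr_gt0.
  congr (_%:E * _); rewrite exprMn exprVn exprS.
  set q := (enorm v ^+ n)%R; set e := enorm v; set i := \1_P0 r.
  have q0 : q != 0%R by rewrite expf_neq0// gt_eqF.
  have e0 : e != 0%R by rewrite gt_eqF.
  by field; rewrite q0 e0.
have -> : \int[leb n.+1]_v \int[mu]_s K v s = \int[mu]_s \int[leb n.+1]_v K v s.
  exact: (@fubini_tonelli _ _ T L _ (leb n.+1) mu _ mK (fun p => K0 _ _)).
transitivity (n.+1%:R%:E * \int[mu]_s \int[leb n.+1]_v Q v s); last first.
  apply: (f_equal (fun y => n.+1%:R%:E * y)).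
  apply: eq_integral => s _.
  case: (boolP (s \in P0)) => [|/negbTE sP]; last first.
    rewrite !integral0_eq// => v _.
      by rewrite /K !indicE sP mulr0 !mul0r mul0e.
    by rewrite /Q !indicE sP mulr0 !mul0r mul0e.
  move=> /[dup] sP; rewrite mem_pos_line => s0.
  pose q (v : T) : \bar R := (\1_B0 (scale_tuple s^-1 v) * 
     s ^+ n * (enorm v / s) ^+ n.+1)%:E * f v.
  have mq : measurable_fun setT q.
    apply: emeasurable_funM => //; apply/measurable_EFinP; apply: measurable_funM.
      apply: measurable_funM => //; apply: (measurableT_comp mB).
      exact: measurable_scale.
    by apply: measurable_funX; apply: measurable_funM => //; exact: measurable_enorm.
  have q0 v : 0 <= q v.
    have si : (0 <= s^-1)%R by rewrite invr_ge0 ltW.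
    apply: mule_ge0 => //; rewrite lee_fin; apply: mulr_ge0.
      by rewrite mulr_ge0// exprn_ge0// ltW.
    by rewrite exprn_ge0// mulr_ge0 ?enorm_ge0.
  transitivity (\int[leb n.+1]_v q (scale_tuple s v)).
    rewrite ge0_integral_scale// -ge0_integralZl//; last first.
      by rewrite lee_fin exprn_ge0// invr_ge0 ltW.
    apply: eq_integral => v _; rewrite /q /Q muleA -EFinM [\1_P0 _]indicE sP.
    congr (_%:E * _); rewrite mulr1 exprMn !exprVn.
    set b := \1__ _; set e := (enorm v ^+ n.+1)%R; rewrite !exprS.
    set u := (s ^+ n)%R; have u0 : u != 0%R by rewrite expf_neq0// gt_eqF.
    have sn0 : s != 0%R by rewrite gt_eqF.
    by field; rewrite u0 sn0.
  apply: eq_integral => v _; rewrite /q /K [\1_P0 _]indicE sP mulr1.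
  rewrite scale_tupleA mulVf ?gt_eqF// scale_tuple1 enorm_scale ?ltW//.
  by rewrite [(s * enorm v)%R]mulrC mulfK// gt_eqF.
have <- : \int[leb n.+1]_v \int[mu]_s Q v s = \int[mu]_s \int[leb n.+1]_v Q v s.
  exact: (@fubini_tonelli _ _ T L _ (leb n.+1) mu _ mQ (fun p => Q0 _ _)).
rewrite -ge0_integralZl//; last 2 first.
- exact: (@measurable_fun_fubini_tonelli_F _ _ T L _ mu _ mQ (fun p => Q0 _ _)).
- by move=> v _; apply: integral_ge0 => s _.
pose N := [set v : T | enorm v = 0%R].
have mN : measurable N.
  rewrite (_ : N = setT `&` (@enorm R n.+1) @^-1` [set 0%R]); last first.
    by rewrite setTI.
  exact: measurable_enorm.
rewrite [LHS](ge0_negligible_integral mN)//; last exact: lebesgue_tuple_enorm0.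
rewrite [RHS](ge0_negligible_integral mN)//; last 3 first.
- apply: emeasurable_funM => //.
  exact: (@measurable_fun_fubini_tonelli_F _ _ T L _ mu _ mQ (fun p => Q0 _ _)).
- by move=> v _; rewrite mule_ge0//; apply: integral_ge0 => s _.
- exact: lebesgue_tuple_enorm0.
apply: eq_integral => v; rewrite inE => -[_ /= /eqP vn0].
have v0 : (0 < enorm v)%R by rewrite lt_neqAle eq_sym vn0 enorm_ge0.
transitivity (n.+1%:R%:E * (\int[mu]_(s in `[(enorm v), +oo[)
   ((enorm v ^+ n.+1)%:E * f v * (s^-1 ^+ n.+2)%:E))); last first.
  congr (_ * _); rewrite integral_mkcond; apply: eq_integral => s _.
  rewrite patchE /Q.
  case: ifPn => [|/negP]; rewrite inE/= in_itv/= andbT => sv.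
    have s0 : (0 < s)%R := lt_le_trans v0 sv.
    rewrite !indicE mem_pos_line mem_punctured_ball s0 enorm_scale ?invr_ge0 ?(ltW s0)//.
    rewrite mulr_gt0 ?invr_gt0//= [(s^-1 * enorm v)%R]mulrC ler_pdivrMr// mul1r sv.
    by rewrite !mul1r EFinM muleAC.
  have [s0|s0] := leP s 0%R.
    by rewrite [\1_P0 _]indicE mem_pos_line ltNge s0 mulr0 !mul0r mul0e.
  rewrite indicE mem_punctured_ball enorm_scale ?invr_ge0 ?(ltW s0)// [(_ * enorm v)%R]mulrC.
  by rewrite ler_pdivrMr// mul1r (negbTE (introN idP sv)) andbF !mul0r mul0e.
rewrite ge0_integralZl//; last 3 first.
- apply/measurable_funTS/measurable_EFinP/measurable_funX; exact: measurable_invr.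
- move=> s; rewrite /= in_itv/= andbT => sv.
  by rewrite lee_fin exprn_ge0// invr_ge0 ltW// (lt_le_trans v0).
- by rewrite mule_ge0// lee_fin exprn_ge0// ltW.
rewrite integral_inv_expr// muleAC muleA muleA -!EFinM muleC.
rewrite -[LHS]mule1; congr (_ * _%:E).
rewrite exprVn; set e := (enorm v ^+ n.+1)%R.
have e0 : e != 0%R by rewrite expf_neq0.
have nn0 : n.+1%:R != 0%R :> R by rewrite pnatr_eq0.
by field; rewrite e0 nat1r nn0.
Qed.

End polar2.

(** * Oscillatory integrals with a logarithmic phase *)

Section line_integrals.
Context {R : realType}.
Local Notation mu := (@lebesgue_measure R).
Implicit Types (f g h : R -> R) (a b c k l al : R).

Lemma within_continuous_itv f a b :
  (forall x, a <= x <= b -> {for x, continuous f}) -> {within `[a, b], continuous f}.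
Proof.
move=> cf; apply: continuous_in_subspaceT => x; rewrite inE/= in_itv/= => xab.
exact: cf.
Qed.

Lemma continuous_integrable f a b :
  (forall x, a <= x <= b -> {for x, continuous f}) ->
  mu.-integrable `[a, b] (EFin \o f).
Proof.
move=> cf; apply: continuous_compact_integrable; first exact: segment_compact.
exact: within_continuous_itv.
Qed.

(** The common form of all integrations by parts below: G is the boundary term
    and M' a bound for the remaining integrand. The difference between the
    integral of f up to x and G x grows at most like M. *)
Lemma Rintegral_le_primitive f G G' M M' a b : a <= b ->
  (forall x, a <= x <= b -> {for x, continuous f}) ->
  (forall x, a <= x <= b -> is_derive x 1 G (G' x)) ->
  (forall x, a <= x <= b -> is_derive x 1 M (M' x)) ->
  (forall x, a <= x <= b -> `|f x - G' x| <= M' x) ->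
  `|\int[mu]_(x in `[a, b]) f x| <= `|G b - G a| + (M b - M a).
Proof.
rewrite le_eqVlt => /predU1P[<- _ _ _ _|ab cf dG dM fG].
  by rewrite set_itv1 Rintegral_set1 !subrr normr0 addr0.
pose I x := \int[mu]_(t in `[a, x]) f t.
have fi := continuous_integrable cf.
have cI : {within `[a, b], continuous I}.
  exact: parameterized_integral_continuous (ltW ab) fi.
have dI x : a < x < b -> is_derive x 1 I (f x).
  move=> /andP[ax xb].
  have [] := continuous_FTC1_closed xb fi ax _.
    by apply: cf; rewrite !ltW.
  by move=> dIx <-; rewrite derive1E; exact: DeriveDef.
have cM : {within `[a, b], continuous M}.
  by apply: within_continuous_itv => x /dM/der_continuous.
have cG : {within `[a, b], continuous G}.
  by apply: within_continuous_itv => x /dG/der_continuous.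
have Ia : I a = 0 by rewrite /I set_itv1 Rintegral_set1.
have sub x : x \in `]a, b[ -> a < x < b /\ a <= x <= b.
  by rewrite in_itv/= => /andP[ax xb]; rewrite ax xb !ltW.
have up e : `|e| <= 1 -> e * (I b - G b) - M b <= e * (I a - G a) - M a.
  move=> e1; rewrite -subr_le0.
  have [||c cab ->] := @MVT _ (fun x => e * (I x - G x) - M x)
     (fun x => e * (f x - G' x) - M' x) a b ab.
  - move=> x /sub[x1 x2]; have dIx := dI x x1; have dGx := dG x x2.
    have dMx := dM x x2; eapply der_eq; first by der.
    by rewrite /= mul0r add0r.
  - move=> x; apply: cvgB; last exact: cM.
    by apply: cvgM; [exact: cvg_cst|apply: cvgB; [exact: cI|exact: cG]].
  - apply: mulr_le0_ge0; last by rewrite subr_ge0 ltW.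
    have [_ /fG fGc] := sub c cab.
    rewrite subr_le0; apply: le_trans fGc; apply: le_trans (ler_norm _) _.
    by rewrite normrM ler_piMl.
have u1 := up 1; have u2 := up (-1).
rewrite normrN normr1 in u1 u2; have {}u1 := u1 (lexx _); have {}u2 := u2 (lexx _).
rewrite -/(I b) Ia in u1 u2 *.
have H1 := ler_norm (G b - G a); have H2 := ler_norm (- (G b - G a)).
by rewrite normrN in H2; rewrite ler_norml; apply/andP; split; lra.
Qed.

Lemma Rintegral_split f a c b : a <= c -> c <= b ->
  (forall x, a <= x <= b -> {for x, continuous f}) ->
  \int[mu]_(x in `[a, b]) f x =
  \int[mu]_(x in `[a, c]) f x + \int[mu]_(x in `[c, b]) f x.
Proof.
move=> ac cb cf; have fi := continuous_integrable cf.
have := Rintegral_itvB (x := c) fi; rewrite !bnd_simp => /(_ ac cb).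
rewrite [X in _ = X -> _]Rintegral_itv_obnd_cbnd => [<-|]; first by rewrite addrC subrK.
apply: integrableS fi => //; apply: subset_itvr; rewrite bnd_simp //.
Qed.

Definition phase k l al (r : R) := r * l + k * ln r + al.

Lemma der_phase k l al (r : R) : 0 < r ->
  is_derive r 1 (phase k l al) (l + k / r).
Proof.
move=> r0; rewrite /phase; eapply der_eq; first by der.
by rewrite /=; ring.
Qed.

Lemma normr_cos_le1 (y : R) : `|cos y| <= 1.
Proof. by rewrite ler_norml cos_geN1 cos_le1. Qed.

Lemma normr_sin_le1 (y : R) : `|sin y| <= 1.
Proof. by rewrite ler_norml sin_geN1 sin_le1. Qed.

Lemma normrM_le1 (y z K : R) : `|y| <= K -> `|z| <= 1 -> `|y * z| <= K.
Proof.
move=> yK z1; rewrite normrM; apply: le_trans yK.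
by rewrite ler_piMr.
Qed.

(** Up to the scale 1 / |l| the term l of the phase derivative contributes at
    most 1 in total, and without it sin(phase) would be a primitive. *)
Lemma osc_log_near k l al a b : 0 < a <= b -> b * `|l| <= 1 ->
  `|\int[mu]_(r in `[a, b]) (k * (r^-1 * cos (phase k l al r)))| <= 3.
Proof.
move=> /andP[a0 ab] bl.
have p r : a <= r <= b -> 0 < r by move=> /andP[ar _]; exact: lt_le_trans ar.
apply: le_trans (@Rintegral_le_primitive _ (fun r => sin (phase k l al r))
  (fun r => cos (phase k l al r) * (l + k / r)) (fun r => r * `|l|) (fun r => `|l|)
  _ _ ab _ _ _ _) _.
- move=> r /p r0; have dp := der_phase k l al r0.
  by eapply der_continuous; der; rewrite gt_eqF.
- move=> r /p r0; have dp := der_phase k l al r0.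
  by eapply der_eq; first by der.
- move=> r _; eapply der_eq; first by der.
  by rewrite /= mul1r mulr0 addr0.
- move=> r /p r0; set c := cos _.
  have -> : k * (r^-1 * c) - c * (l + k / r) = - (l * c) by ring.
  rewrite normrN; apply: normrM_le1 => //; exact: normr_cos_le1.
have H := ler_normB (sin (phase k l al b)) (sin (phase k l al a)).
have H1 := normr_sin_le1 (phase k l al b); have H2 := normr_sin_le1 (phase k l al a).
have H3 : 0 <= a * `|l| by rewrite mulr_ge0// ltW.
lra.
Qed.

(** Above the scale 1 / |l| only the term l of the phase derivative is used:
    integrating by parts against sin(phase) / (l r) leaves a remainder of size
    (1 + |k|) / (|l| r^2). *)
Lemma osc_log_far k l al a b : 0 < a <= b -> 1 <= a * `|l| ->
  `|\int[mu]_(r in `[a, b]) (r^-1 * cos (phase k l al r))| <= 3 + `|k|.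
Proof.
move=> /andP[a0 ab] al1.
have p r : a <= r <= b -> 0 < r by move=> /andP[ar _]; exact: lt_le_trans ar.
have l0 : 0 < `|l| by rewrite -(pmulr_rgt0 _ a0) (lt_le_trans _ al1).
have ln0 : l != 0 by rewrite -normr_gt0.
have b0 : 0 < b by exact: lt_le_trans ab.
apply: le_trans (@Rintegral_le_primitive _ (fun r => l^-1 * (r^-1 * sin (phase k l al r)))
  (fun r => l^-1 * (- r ^- 2 * sin (phase k l al r)
     + r^-1 * (cos (phase k l al r) * (l + k / r))))
  (fun r => - ((1 + `|k|) / `|l| / r)) (fun r => (1 + `|k|) / `|l| * r ^- 2)
  _ _ ab _ _ _ _) _.
- move=> r /p r0; have dp := der_phase k l al r0.
  by eapply der_continuous; der; rewrite gt_eqF.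
- move=> r /p r0; have dp := der_phase k l al r0.
  eapply der_eq; first by der; rewrite gt_eqF.
  by rewrite /=; field; rewrite ln0 gt_eqF.
- move=> r /p r0; eapply der_eq; first by der; rewrite gt_eqF.
  by rewrite /=; field; rewrite !gt_eqF.
- move=> r /p r0; set c := cos _; set s := sin _.
  have -> : r^-1 * c - l^-1 * (- r ^- 2 * s + r^-1 * (c * (l + k / r)))
     = (l^-1 * r ^- 2) * (s - k * c).
    by field; rewrite ln0 gt_eqF.
  rewrite !normrM normfV [`|r ^- 2|]gtr0_norm ?invr_gt0 ?exprn_gt0//.
  rewrite (_ : (1 + `|k|) / `|l| * r ^- 2 = `|l|^-1 * r ^- 2 * (1 + `|k|)); last by ring.
  rewrite ler_wpM2l//; first by rewrite mulr_ge0 ?invr_ge0 ?exprn_ge0 ?(ltW r0).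
  apply: (le_trans (ler_normB _ _)); apply: lerD; first exact: normr_sin_le1.
  by apply: normrM_le1 => //; exact: normr_cos_le1.
have Gle r : a <= r <= b -> `|l^-1 * (r^-1 * sin (phase k l al r))| <= 1.
  move=> /[dup] /p r0 /andP[ar _].
  rewrite mulrA; apply: normrM_le1; last exact: normr_sin_le1.
  rewrite -invfM normfV normrM (gtr0_norm r0) invf_le1 ?mulr_gt0// mulrC.
  by apply: le_trans al1 _; rewrite ler_wpM2r.
have Hb := Gle b; have Ha := Gle a.
rewrite !lexx !ab /= in Hb Ha; have {}Hb := Hb isT; have {}Ha := Ha isT.
have H := ler_normB (l^-1 * (b^-1 * sin (phase k l al b)))
  (l^-1 * (a^-1 * sin (phase k l al a))).
have Hm : (1 + `|k|) / `|l| / a <= 1 + `|k|.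
  rewrite -mulrA -invfM ler_pdivrMr ?mulr_gt0// [`|l| * a]mulrC.
  by rewrite ler_peMr// addr_ge0.
have Hn : 0 <= (1 + `|k|) / `|l| / b.
  by apply: divr_ge0; [apply: divr_ge0; [exact: addr_ge0|exact: ltW]|exact: ltW].
lra.
Qed.

(** The point is the uniformity in a, b and l: with dr / r being invariant under
    dilations, only the factor k prevents a logarithmic divergence. *)
Lemma osc_log k l al a b : 0 < a <= b ->
  `|\int[mu]_(r in `[a, b]) (k * (r^-1 * cos (phase k l al r)))| <= 6 * (1 + `|k|) ^+ 2.
Proof.
move=> /andP[a0 ab].
have cf (x : R) : 0 < x -> {for x, continuous (fun r : R => r^-1 * cos (phase k l al r))}.
  by move=> x0; have dp := der_phase k l al x0; eapply der_continuous; der; rewrite gt_eqF.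
have ckf (x : R) : 0 < x ->
    {for x, continuous (fun r : R => k * (r^-1 * cos (phase k l al r)))}.
  by move=> x0; have dp := der_phase k l al x0; eapply der_continuous; der; rewrite gt_eqF.
have k0 : 0 <= `|k| by [].
have far (c : R) : a <= c <= b -> 1 <= c * `|l| ->
    `|\int[mu]_(r in `[c, b]) (k * (r^-1 * cos (phase k l al r)))| <= `|k| * (3 + `|k|).
  move=> /andP[ac cb] cl; have c0 : 0 < c by exact: lt_le_trans ac.
  rewrite RintegralZl//; last first.
    by apply: continuous_integrable => x /andP[/(lt_le_trans c0) + _]; exact: cf.
  by rewrite normrM ler_wpM2l// osc_log_far// c0 cb.
have [bl|bl] := leP (b * `|l|) 1.
  by apply: (le_trans (osc_log_near _ _ _ bl)); rewrite ?a0//; nra.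
have [al1|al1] := leP 1 (a * `|l|).
  apply: (le_trans (far a _ al1)); first by rewrite lexx.
  by nra.
have l0 : 0 < `|l| by rewrite -(pmulr_rgt0 _ (lt_le_trans a0 ab)) (lt_trans _ bl).
pose c := `|l|^-1.
have ac : a <= c by rewrite /c -[leRHS]mul1r ler_pdivlMr// ltW.
have cb : c <= b by rewrite /c -[leLHS]mul1r ler_pdivrMr// ltW.
have cl : c * `|l| = 1 by rewrite mulVf// gt_eqF.
rewrite (Rintegral_split ac cb); last first.
  by move=> x /andP[/(lt_le_trans a0) + _]; exact: ckf.
apply: le_trans (ler_normD _ _) _.
have H1 : `|\int[mu]_(r in `[a, c]) (k * (r^-1 * cos (phase k l al r)))| <= 3.
  by apply: osc_log_near; rewrite ?a0 ?cl.
have H2 := far c; rewrite ac cb cl in H2; have {}H2 := H2 isT (lexx _).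
by nra.
Qed.

(** [osc_log] bounds the primitive of the oscillating factor whatever the
    endpoints, so an amplitude h costs its supremum and its variation. *)
Lemma osc_log_amplitude k l al h h' (M M' : R -> R) (K : R) a b : 0 < a <= b ->
  (forall x : R, 0 < x -> is_derive x 1 h (h' x)) ->
  (forall x : R, 0 < x -> is_derive x 1 M (M' x)) ->
  (forall x, a <= x <= b -> `|h' x| <= M' x) ->
  (forall x, a <= x <= b -> `|h x| <= K) ->
  `|\int[mu]_(r in `[a, b]) (k * (r^-1 * cos (phase k l al r)) * h r)| <=
  6 * (1 + `|k|) ^+ 2 * (2 * K + (M b - M a)).
Proof.
move=> /andP[a0 ab] dh dM hM hK.
pose g r := k * (r^-1 * cos (phase k l al r)).
have cg (x : R) : 0 < x -> {for x, continuous g}.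
  by move=> x0; have dp := der_phase k l al x0; eapply der_continuous; der; rewrite gt_eqF.
(* starting the primitive strictly before a makes it differentiable at a *)
pose a' := a / 2.
have a'0 : 0 < a' by rewrite divr_gt0.
have a'a : a' < a by rewrite /a' ltr_pdivrMr// mulr_natr mulr2n ltrDl.
pose I r := \int[mu]_(t in `[a', r]) g t.
pose Q := 6 * (1 + `|k|) ^+ 2.
have IQ r : a' <= r -> `|I r| <= Q by move=> ar; apply: osc_log; rewrite a'0.
have Q0 : 0 <= Q by rewrite mulr_ge0// exprn_ge0// addr_ge0.
have p (r : R) : a <= r <= b -> 0 < r by move=> /andP[ar _]; exact: lt_le_trans ar.
have a'r (r : R) : a <= r <= b -> a' < r by move=> /andP[ar _]; exact: lt_le_trans ar.
have dI (x : R) : a' < x -> is_derive x 1 I (g x).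
  move=> ax.
  have xx : x < x + 1 by rewrite ltrDl.
  have gi : mu.-integrable `[a', (x + 1)] (EFin \o g).
    by apply: continuous_integrable => y /andP[/(lt_le_trans a'0) + _]; exact: cg.
  have [] := continuous_FTC1_closed xx gi ax (cg _ (lt_trans a'0 ax)).
  by move=> dIx <-; rewrite derive1E; exact: DeriveDef.
apply: le_trans (@Rintegral_le_primitive _ (fun r => I r * h r)
  (fun r => g r * h r + I r * h' r) (fun r => Q * M r) (fun r => Q * M' r)
  _ _ ab _ _ _ _) _.
- move=> x /p x0; have dp := der_phase k l al x0; have dhx := dh x x0.
  by eapply der_continuous; der; rewrite gt_eqF.
- move=> x xab; have dIx := dI x (a'r x xab); have dhx := dh x (p x xab).
  by eapply der_eq; first by der.
- move=> x /p /dM dMx; eapply der_eq; first by der.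
  by rewrite /= mul0r add0r.
- move=> x xab.
  rewrite -/(g x) opprD addrA subrr sub0r normrN normrM ler_pM//; last exact: hM.
  exact/IQ/ltW/a'r.
have H (x : R) : a <= x <= b -> `|I x * h x| <= Q * K.
  by move=> xab; rewrite normrM ler_pM//; [exact/IQ/ltW/a'r|exact: hK].
have Ha := H a; have Hb := H b; rewrite !lexx !ab /= in Ha Hb.
have {}Ha := Ha isT; have {}Hb := Hb isT.
have H1 := ler_normB (I b * h b) (I a * h a).
rewrite -/Q; lra.
Qed.

End line_integrals.

(** * Integrals of powers, and amplitudes with finitely many derivatives *)

Section power_integrals.
Context {R : realType}.
Local Notation mu := (@lebesgue_measure R).

Lemma powRB1 (x a : R) : 0 < x -> x `^ (a - 1) = x `^ a / x.
Proof.
by move=> x0; rewrite powRB ?powRr1 ?(ltW x0)//; rewrite (gt_eqF x0) implybT.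
Qed.

(** The integrand may be unbounded at 0, so the fundamental theorem of calculus
    is applied on the segments [b / (i + 1), b], which exhaust ]0, b]. *)
Lemma integral_powR_le (b m : R) : 0 < b -> 0 < m ->
  (\int[mu]_(r in `]0%R, b]) (r `^ (m - 1))%:E <= (b `^ m / m)%:E)%E.
Proof.
move=> b0 m0.
pose F (i : nat) : set R := `[(b / i.+1%:R), b]%classic.
have FU : \bigcup_i F i = `]0%R, b]%classic.
  apply/seteqP; split => x /=.
    move=> [i _]; rewrite /F/= !in_itv/= => /andP[ix ->]; rewrite andbT.
    by apply: lt_le_trans ix; rewrite divr_gt0.
  rewrite in_itv/= => /andP[x0 xb]; exists (Num.bound (b / x)) => //.
  rewrite /F/= in_itv/= xb andbT ler_pdivrMr// -ler_pdivrMl//  mulrC.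
  have /archi_boundP/ltW/le_trans : 0 <= b / x by rewrite divr_ge0 ?ltW.
  by apply; rewrite ler_nat.
have Fp i r : F i r -> 0 < r.
  by rewrite /F/= in_itv/= => /andP[+ _]; apply: lt_le_trans; rewrite divr_gt0.
rewrite -FU.
apply: (cvge_to_le (@ge0_nondecreasing_set_cvg_integral _ (measurableTypeR R) _ F
  (fun r => (r `^ (m - 1))%:E) mu _ _ _ _)).
- move=> i j ij; apply/subsetPset => x; rewrite /F/= !in_itv/= => /andP[ix ->].
  rewrite andbT; apply: le_trans ix; rewrite ler_pM2l// lef_pV2 ?posrE//.
  by rewrite ler_nat ltnS.
- by move=> i; rewrite /F; exact: measurable_itv.
- by move=> i; apply/measurable_funTS/measurable_EFinP; exact: measurable_powR.
- by move=> i x _; rewrite lee_fin powR_ge0.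
apply: nearW => i.
have Fp' x : b / i.+1%:R <= x <= b -> 0 < x.
  by move=> xi; apply: (Fp i); rewrite /F/= in_itv.
have dM (x : R) : 0 < x -> is_derive x 1 (fun r => r `^ m / m) (x `^ (m - 1)).
  move=> x0; eapply der_eq; first by der.
  by rewrite /=; field; rewrite gt_eqF.
have cf x : b / i.+1%:R <= x <= b -> {for x, continuous (fun r : R => r `^ (m - 1))}.
  by move=> /Fp' x0; eapply der_continuous; der.
have bi : b / i.+1%:R <= b by rewrite ler_pdivrMr// ler_peMr ?ler1n ?ltW.
have := @Rintegral_le_primitive _ (fun r => r `^ (m - 1)) (fun=> 0) (fun=> 0)
  (fun r => r `^ m / m) (fun r => r `^ (m - 1)) _ _ bi cf _ _ _.
rewrite subrr normr0 add0r => H.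
have {}H := H (fun x _ => der_cst _ _) (fun x xi => dM x (Fp' x xi)).
rewrite -[leLHS]fineK; last first.
  exact: (@integrable_fin_num _ _ _ mu `[(b / i.+1%:R), b] _ _
    (continuous_integrable cf)).
rewrite lee_fin; apply: le_trans (ler_norm _) _; apply: le_trans (H _) _.
  by move=> x _; rewrite subr0 ger0_norm// powR_ge0.
by rewrite gerBl divr_ge0 ?powR_ge0 ?ltW.
Qed.

Lemma integrable_powR (b m K : R) (g : R -> R) : 0 < b -> 0 < m ->
  measurable_fun [set: R] g -> (forall r, 0 < r <= b -> `|g r| <= K) ->
  mu.-integrable `]0, b] (EFin \o (fun r => r `^ (m - 1) * g r)).
Proof.
move=> b0 m0 mg gK; apply/integrableP; split.
  by apply/measurable_EFinP/measurable_funTS; apply: measurable_funM.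
have K0 : 0 <= K by apply: le_trans (gK b _); rewrite ?b0 ?lexx.
apply: (@le_lt_trans _ _ (\int[mu]_(r in `]0%R, b]) (K%:E * (r `^ (m - 1))%:E))%E).
  apply: ge0_le_integral => //.
  - apply: measurableT_comp => //; apply/measurable_EFinP/measurable_funTS.
    by apply: measurable_funM.
  - apply/measurable_funTS; apply: emeasurable_funM => //.
    by apply/measurable_EFinP; exact: measurable_powR.
  move=> r; rewrite /= in_itv/= => rb; rewrite -EFinM lee_fin normrM.
  by rewrite ger0_norm ?powR_ge0// mulrC ler_wpM2r ?powR_ge0// gK.
rewrite ge0_integralZl//; last 2 first.
- by apply/measurable_funTS/measurable_EFinP; exact: measurable_powR.
- by move=> r _; rewrite lee_fin powR_ge0.
apply: (@le_lt_trans _ _ (K%:E * (b `^ m / m)%:E)%E); last by rewrite -EFinM ltry.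
by rewrite lee_wpmul2l ?lee_fin// integral_powR_le.
Qed.

Lemma Rintegral_powR_le (b m K : R) (g : R -> R) : 0 < b -> 0 < m ->
  measurable_fun [set: R] g -> (forall r, 0 < r <= b -> `|g r| <= K) ->
  `|\int[mu]_(r in `]0, b]) (r `^ (m - 1) * g r)| <= K * (b `^ m / m).
Proof.
move=> b0 m0 mg gK; have K0 : 0 <= K by apply: le_trans (gK b _); rewrite ?b0 ?lexx.
have gi := integrable_powR b0 m0 mg gK.
apply: le_trans (le_normr_Rintegral _ gi) _ => //.
have Ki : mu.-integrable `]0, b] (EFin \o (fun r => r `^ (m - 1) * K)).
  by apply: (@integrable_powR b m K) => // r _; rewrite ger0_norm.
apply: (@le_trans _ _ (\int[mu]_(r in `]0, b]) (r `^ (m - 1) * K))).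
  apply: le_Rintegral => //; first exact: (integrable_norm gi).
  move=> r; rewrite /= in_itv/= => rb; rewrite normrM.
  by rewrite ger0_norm ?powR_ge0// ler_wpM2l ?powR_ge0// gK.
rewrite -lee_fin /Rintegral fineK; last exact: (integrable_fin_num _ Ki).
under eq_integral do rewrite mulrC EFinM.
rewrite ge0_integralZl//; last 2 first.
- by apply/measurable_funTS/measurable_EFinP; exact: measurable_powR.
- by move=> r _; rewrite lee_fin powR_ge0.
by rewrite EFinM lee_wpmul2l ?lee_fin// integral_powR_le.
Qed.

End power_integrals.
Section smoothness.
Context {R : realType}.
Implicit Types (f g : R -> R) (k : nat).

(** Finite order smoothness, with witnesses for the derivatives: one integration
    by parts consumes one derivative, and multiplying by the variable, as in
    r psi'(r), consumes none. *)
Fixpoint ncontdiff k f : Prop :=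
  if k is j.+1 then exists2 f' : R -> R,
    (forall x : R, is_derive x 1 f (f' x)) & ncontdiff j f'
  else continuous f.

Lemma smooth_ncontdiff f k : smooth f -> ncontdiff k f.
Proof.
move=> sf; have df j (x : R) : is_derive x 1 (derive1n j f) (derive1n j.+1 f x).
  by rewrite derive1nS derive1E; apply/derivableP.
suff: forall j, ncontdiff k (derive1n j f) by move/(_ 0%N).
elim: k => [|k IH] j /=; first by move=> x; exact: (der_continuous (df j x)).
by exists (derive1n j.+1 f).
Qed.

Lemma ncontdiffW k f : ncontdiff k.+1 f -> ncontdiff k f.
Proof.
elim: k f => [f [f' df _] x|k IH f [f' df /IH f'k]].
  exact: (der_continuous (df x)).
by exists f'.
Qed.

Lemma ncontdiff_continuous k f : ncontdiff k f -> continuous f.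
Proof. by elim: k f => // k IH f /ncontdiffW/IH. Qed.

Lemma ncontdiffD k f g : ncontdiff k f -> ncontdiff k g ->
  ncontdiff k (fun x => f x + g x).
Proof.
elim: k f g => [f g cf cg x|k IH f g [f' df kf] [g' dg kg]].
  by apply: cvgD; [exact: cf|exact: cg].
exists (fun x => f' x + g' x); last exact: IH.
by move=> x; apply: der_add.
Qed.

Lemma ncontdiffZ k (a : R) f : ncontdiff k f -> ncontdiff k (fun x => a * f x).
Proof.
elim: k f => [f cf x|k IH f [f' df kf]].
  by apply: cvgM; [exact: cvg_cst|exact: cf].
exists (fun x => a * f' x); last exact: IH.
move=> x; have dfx := df x; eapply der_eq; [der|by rewrite /= mul0r add0r].
Qed.

Lemma ncontdiffX k f : ncontdiff k f -> ncontdiff k (fun x => x * f x).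
Proof.
elim: k f => [f cf x|k IH f kf].
  by apply: cvgM; [exact: cvg_id|exact: cf].
have := kf => -[f' df kf']; exists (fun x => f x + x * f' x).
  by move=> x; have dfx := df x; eapply der_eq; [der|by rewrite /= mul1r].
by apply: ncontdiffD; [exact: ncontdiffW|exact: IH].
Qed.

Lemma continuous_bounded_itv f (a b : R) : continuous f ->
  exists2 K : R, 0 <= K & forall x, a <= x <= b -> `|f x| <= K.
Proof.
move=> cf; have [ab|ab] := leP a b; last first.
  by exists 0 => // x /andP[ax xb]; move: (le_trans ax xb); rewrite leNgt ab.
have [|c _ cM] := @EVT_max _ (fun x => `|f x|) a b ab.
  apply: within_continuous_itv => x _.
  by apply: cvg_norm; exact: cf.
by exists `|f c| => // x xab; apply: cM; rewrite in_itv.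
Qed.

End smoothness.

(** * Decay of the radial integral away from the cone *)

Section decay.
Context {R : realType}.
Local Notation mu := (@lebesgue_measure R).
Implicit Types (k : nat) (psi : R -> R).

Lemma continuous_mul_at (f g : R -> R) (x : R) : {for x, continuous f} ->
  {for x, continuous g} -> {for x, continuous (fun y => f y * g y)}.
Proof. by move=> cf cg; apply: cvgM. Qed.

Lemma continuous_phase_cos (k l al x : R) : 0 < x ->
  {for x, continuous (fun r => cos (phase k l al r))}.
Proof.
by move=> x0; have dp := der_phase k l al x0; eapply der_continuous; der.
Qed.

Lemma continuous_powR (b x : R) : 0 < x -> {for x, continuous (fun r : R => r `^ b)}.
Proof. by move=> x0; eapply der_continuous; der. Qed.

Lemma phaseBpihalf (k l al r : R) :
  cos (phase k l (al - pi / 2) r) = sin (phase k l al r).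
Proof. by rewrite -cosBpihalf /phase addrA. Qed.

(** Each integration by parts turns the amplitude r^be psi(r) into r^(be-1) times
    be psi + r psi' and ka psi, and gains a factor 1 / |l| = a, while the
    boundary term at a has size a^(be+1). The induction stops when r^be is
    integrable at infinity, that is be + 1 < 0. The amplitude vanishes beyond
    some b < 1 so that its derivatives vanish at 1 as well. *)
Lemma osc_symbol_far k (b : R) : b < 1 -> forall (be : R) psi,
  be + 1 < k%:R -> ncontdiff k psi ->
  (forall r, b < r -> psi r = 0) ->
  exists2 C : R, 0 <= C & forall ka al l a : R, 0 < a <= 1 -> a * `|l| = 1 ->
    `|\int[mu]_(r in `[a, 1]) (r `^ be * (psi r * cos (phase ka l al r)))| <=
    C * (1 + `|ka|) ^+ k * a `^ (be + 1).
Proof.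
move=> b1; have cont (be : R) psi (ka l al x : R) : continuous psi -> 0 < x ->
    {for x, continuous (fun r => r `^ be * (psi r * cos (phase ka l al r)))}.
  move=> cpsi x0; apply: continuous_mul_at; first exact: continuous_powR.
  by apply: continuous_mul_at; [exact: cpsi|exact: continuous_phase_cos].
elim: k => [|k IH] be psi bek kpsi psi0.
  have [K K0 psiK] := continuous_bounded_itv 0 1 (ncontdiff_continuous kpsi).
  have b10 : be + 1 != 0 by rewrite lt_eqF.
  exists (K / - (be + 1)); first by rewrite divr_ge0// oppr_ge0 ltW.
  move=> ka al l a /andP[a0 a1] al1.
  have p (r : R) : a <= r <= 1 -> 0 < r by move=> /andP[ar _]; exact: lt_le_trans ar.
  have H := @Rintegral_le_primitive _
    (fun r => r `^ be * (psi r * cos (phase ka l al r)))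
    (fun=> 0) (fun=> 0) (fun r => K * (r `^ (be + 1) / (be + 1))) (fun r => K * r `^ be)
    a 1 a1.
  apply: le_trans (H _ _ _ _) _.
  - by move=> x /p x0; exact: cont kpsi x0.
  - move=> x /p x0; eapply der_eq; first by der.
    by rewrite /= addrK; field.
  - move=> x /[dup] /p x0 /andP[ax x1]; rewrite subr0 normrM ger0_norm ?powR_ge0//.
    rewrite mulrC ler_wpM2r ?powR_ge0//; apply: normrM_le1; last exact: normr_cos_le1.
    by apply: psiK; rewrite x1 ltW.
  rewrite subrr normr0 add0r expr0 mulr1 powR1 invrN.
  have -> : K * (1 / (be + 1)) - K * (a `^ (be + 1) / (be + 1)) =
    K * - (be + 1)^-1 * a `^ (be + 1) - K * - (be + 1)^-1 by field.
  rewrite gerBl mulr_ge0// oppr_ge0 invr_le0 ltW//.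
have [psi' dpsi kpsi'] := kpsi.
pose psi1 r := be * psi r + r * psi' r.
have kpsi1 : ncontdiff k psi1.
  by apply: ncontdiffD; [exact/ncontdiffZ/ncontdiffW|exact: ncontdiffX].
have psi10 r : b < r -> psi1 r = 0.
  move=> br; rewrite /psi1 psi0// mulr0 add0r.
  suff -> : psi' r = 0 by rewrite mulr0.
  have [_ <-] := dpsi r.
  rewrite (@near_eq_derive _ _ _ psi (fun=> 0)) ?derive_cst// ?oner_neq0//.
  near=> y; apply: psi0; near: y; exact: lt_nbhsr.
have bk : be - 1 + 1 < k%:R by rewrite subrK -(ltrD2r 1) natr1.
have [C1 C10 H1] := IH _ _ bk kpsi1 psi10.
have [C2 C20 H2] := IH _ _ bk (ncontdiffW kpsi) psi0.
have [K K0 psiK] := continuous_bounded_itv 0 1 (ncontdiff_continuous kpsi).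
exists (K + C1 + C2); first by rewrite !addr_ge0.
move=> ka al l a a01 al1; have /andP[a0 a1] := a01.
have {}H1 := H1 ka (al - pi / 2) l a a01 al1.
have {}H2 := H2 ka al l a a01 al1.
set f := fun r => r `^ be * (psi r * cos (phase ka l al r)).
set f1 := (X in `|Rintegral _ _ X| <= C1 * _ * _) in H1.
set f2 := (X in `|Rintegral _ _ X| <= C2 * _ * _) in H2.
have p (r : R) : a <= r <= 1 -> 0 < r by move=> /andP[ar _]; exact: lt_le_trans ar.
have cf r : a <= r <= 1 -> {for r, continuous f}.
  by move=> /p; apply: cont; exact: ncontdiff_continuous kpsi.
have cf1 r : a <= r <= 1 -> {for r, continuous f1}.
  by move=> /p; apply: cont; exact: ncontdiff_continuous kpsi1.
have cf2 r : a <= r <= 1 -> {for r, continuous f2}.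
  by move=> /p; apply: cont; exact: ncontdiff_continuous kpsi.
have l0 : 0 < `|l| by rewrite -(pmulr_rgt0 _ a0) al1.
have ln0 : l != 0 by rewrite -normr_gt0.
have aE : a = `|l|^-1 by rewrite -[RHS]mul1r -al1 mulfK// gt_eqF.
have cg r : a <= r <= 1 -> {for r, continuous (fun r => l^-1 * (f1 r + ka * f2 r))}.
  move=> r1; apply: continuous_mul_at; first exact: cvg_cst.
  apply: cvgD; first exact: cf1.
  by apply: continuous_mul_at; [exact: cvg_cst|exact: cf2].
have HG : `|\int[mu]_(r in `[a, 1]) (f r + l^-1 * (f1 r + ka * f2 r))| <=
    K * a `^ (be + 1).
  have H := @Rintegral_le_primitive _ (fun r => f r + l^-1 * (f1 r + ka * f2 r))
    (fun r => l^-1 * (r `^ be * (psi r * sin (phase ka l al r))))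
    (fun r => f r + l^-1 * (f1 r + ka * f2 r)) (fun=> 0) (fun=> 0) a 1 a1.
  apply: le_trans (H _ _ _ _) _.
  - by move=> r r1; apply: cvgD; [exact: cf|exact: cg].
  - move=> r /p r0; have dp := der_phase ka l al r0; have dpsir := dpsi r.
    eapply der_eq; first by der.
    rewrite /= /f /f1 /f2 /psi1 phaseBpihalf powRB1//; field.
    by rewrite ln0 gt_eqF.
  - by move=> r _; rewrite subrr normr0.
  rewrite psi0// mul0r mulr0 mulr0 sub0r normrN subrr addr0.
  rewrite normrM normfV -aE normrM ger0_norm ?powR_ge0// powRD ?powRr1 ?(ltW a0)//; last first.
    by rewrite (gt_eqF a0) implybT.
  set q := a `^ be; set N := `|psi a * _|.
  have -> : a * (q * N) = N * (q * a) by ring.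
  rewrite ler_wpM2r ?mulr_ge0 ?powR_ge0 ?(ltW a0)//.
  apply: normrM_le1; last exact: normr_sin_le1.
  by apply: psiK; rewrite a1 ltW.
have fi := continuous_integrable cf.
have f1i := continuous_integrable cf1.
have f2i := continuous_integrable cf2.
have kf2i : mu.-integrable `[a, 1] (EFin \o (fun r => ka * f2 r)).
  apply: continuous_integrable => r r1.
  by apply: continuous_mul_at; [exact: cvg_cst|exact: cf2].
have f12i : mu.-integrable `[a, 1] (EFin \o (fun r => f1 r + ka * f2 r)).
  apply: continuous_integrable => r r1; apply: cvgD; first exact: cf1.
  by apply: continuous_mul_at; [exact: cvg_cst|exact: cf2].
move: HG; rewrite RintegralD//; last exact: continuous_integrable.
rewrite RintegralZl// RintegralD// RintegralZl//.
set I := \int[mu]_(x in `[a, 1]) f x.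
set I1 := \int[mu]_(x in `[a, 1]) f1 x; set I2 := \int[mu]_(x in `[a, 1]) f2 x.
have {}H1 : `|I1| <= _ := H1; have {}H2 : `|I2| <= _ := H2.
rewrite !subrK in H1 H2.
set P := (1 + `|ka|) ^+ k in H1 H2.
have P1 : 1 <= P by rewrite exprn_ege1// lerDl.
move=> HG.
have abe : a `^ (be + 1) = a * a `^ be.
  rewrite powRD ?powRr1 ?(ltW a0)// 1?mulrC//.
  by rewrite (gt_eqF a0) implybT.
set q := a `^ be in abe H1 H2.
have q0 : 0 <= q by exact: powR_ge0.
have -> : I = I + l^-1 * (I1 + ka * I2) - l^-1 * (I1 + ka * I2) by rewrite addrK.
apply: le_trans (ler_normB _ _) _.
rewrite [`|l^-1 * _|]normrM normfV -aE.
have H3 : `|I1 + ka * I2| <= C1 * P * q + `|ka| * (C2 * P * q).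
  apply: le_trans (ler_normD _ _) _; rewrite lerD// normrM ler_wpM2l//.
apply: le_trans (lerD HG (ler_wpM2l (ltW a0) H3)) _.
rewrite abe exprS -/P.
have -> : K * (a * q) + a * (C1 * P * q + `|ka| * (C2 * P * q)) =
  (K + C1 * P + `|ka| * (C2 * P)) * (a * q) by ring.
rewrite ler_wpM2r ?mulr_ge0 ?(ltW a0)//.
have k0 : 0 <= `|ka| by [].
have e1 : K <= K * (P + `|ka| * P).
  rewrite ler_peMr// (le_trans P1)// lerDl mulr_ge0// (le_trans _ P1)//.
have CP2 : 0 <= C2 * P by rewrite mulr_ge0// (le_trans _ P1).
have CP1 : 0 <= `|ka| * (C1 * P) by rewrite !mulr_ge0// (le_trans _ P1).
lra.
Unshelve. all: by end_near. Qed.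

Lemma measurable_phase_cos (k l al : R) :
  measurable_fun [set: R] (fun r => cos (phase k l al r)).
Proof.
apply: measurableT_comp; first by apply: continuous_measurable_fun; exact: continuous_cos.
apply: measurable_funD => //; apply: measurable_funD; first exact: measurable_funM.
by apply: measurable_funM => //; exact: measurable_ln.
Qed.

Lemma Rintegral_oc_split (f : R -> R) (a b : R) : 0 < a <= b ->
  mu.-integrable `]0, b] (EFin \o f) ->
  \int[mu]_(r in `]0, b]) f r =
  \int[mu]_(r in `]0, a]) f r + \int[mu]_(r in `[a, b]) f r.
Proof.
move=> /andP[a0 ab] fi.
have := Rintegral_itvB (x := a) fi; rewrite !bnd_simp => /(_ (ltW a0) ab).
rewrite [X in _ = X -> _]Rintegral_itv_obnd_cbnd => [<-|]; first by rewrite addrC subrK.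
by apply: integrableS fi => //; apply: subset_itvr; rewrite bnd_simp ltW.
Qed.

(** On ]0, 1/|l|] the absolute value of the integrand has integral
    O(|l|^(-m)); on the rest [osc_symbol_far] applies. *)
Lemma osc_symbol_decay (m b : R) psi : 0 < m -> b < 1 ->
  (forall k, ncontdiff k psi) -> (forall r, b < r -> psi r = 0) ->
  exists C : R, exists N : nat, 0 <= C /\ forall ka al l : R, l != 0 ->
    `|\int[mu]_(r in `]0, 1]) (r `^ (m - 1) * (psi r * cos (phase ka l al r)))| <=
    C * (1 + `|ka|) ^+ N * `|l| `^ (- m).
Proof.
move=> m0 b1 kpsi psi0.
pose N := Num.bound m.
have mN : m - 1 + 1 < N%:R by rewrite subrK archi_boundP ?ltW.
have [C C0 HC] := osc_symbol_far b1 mN (kpsi N) psi0.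
have cpsi := ncontdiff_continuous (kpsi 0%N).
have [K K0 psiK] := continuous_bounded_itv 0 1 cpsi.
have mf ka l al : measurable_fun [set: R] (fun r => psi r * cos (phase ka l al r)).
  apply: measurable_funM; first exact: continuous_measurable_fun.
  exact: measurable_phase_cos.
have fK ka l al r : 0 < r <= 1 -> `|psi r * cos (phase ka l al r)| <= K.
  move=> /andP[r0 r1]; apply: normrM_le1; last exact: normr_cos_le1.
  by apply: psiK; rewrite r1 ltW.
exists (K / m + C), N; split; first by rewrite addr_ge0// divr_ge0// ltW.
move=> ka al l l0.
have Km : 0 <= K / m by rewrite divr_ge0// ltW.
have P1 : 1 <= (1 + `|ka|) ^+ N by rewrite exprn_ege1// lerDl.
have ln0 : 0 < `|l| by rewrite normr_gt0.
have [l1|l1] := leP `|l| 1.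
  apply: le_trans (Rintegral_powR_le ltr01 m0 (mf _ _ _) (fK _ _ _)) _.
  rewrite powR1 mul1r -/(K / m).
  have L1 : 1 <= `|l| `^ (- m).
    rewrite powRN invf_ge1 ?powR_gt0//.
    have : `|l| `^ m <= 1 `^ m by rewrite ge0_ler_powR ?nnegrE// ltW.
    by rewrite powR1.
  have : K / m <= (K / m + C) * (1 + `|ka|) ^+ N.
    apply: (@le_trans _ _ (K / m + C)); first by rewrite lerDl.
    by rewrite ler_peMr// addr_ge0.
  move=> /le_trans; apply; rewrite ler_peMr//.
  by apply: mulr_ge0; [exact: addr_ge0|exact: le_trans ler01 P1].
pose a := `|l|^-1.
have a0 : 0 < a by rewrite invr_gt0.
have a1 : a <= 1 by rewrite invf_le1// ltW.
have aE : a `^ m = `|l| `^ (- m) by rewrite /a -powR_inv1 ?ltW// -powRrM mulN1r.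
rewrite (@Rintegral_oc_split _ a 1) ?a0//; last first.
  by apply: (integrable_powR ltr01 m0 (mf _ _ _) (fK _ _ _)).
apply: le_trans (ler_normD _ _) _.
have A1 : `|\int[mu]_(r in `]0, a]) (r `^ (m - 1) * (psi r * cos (phase ka l al r)))|
    <= K * (a `^ m / m).
  apply: (Rintegral_powR_le a0 m0 (mf _ _ _)) => r /andP[r0 ra].
  by apply: fK; rewrite r0 (le_trans ra).
have A2 := HC ka al l a; rewrite a0 a1 subrK mulVf ?gt_eqF// in A2.
have {}A2 := A2 isT erefl.
apply: le_trans (lerD A1 A2) _; rewrite -aE mulrA.
have -> : K * a `^ m / m + C * (1 + `|ka|) ^+ N * a `^ m =
  (K / m + C * (1 + `|ka|) ^+ N) * a `^ m by ring.
rewrite ler_wpM2r ?powR_ge0// mulrDl lerD2r.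
by rewrite ler_peMr.
Qed.

End decay.

(** * Solutions of Bessel's equation as amplitudes *)

Section bessel.
Context {R : realType}.
Local Notation mu := (@lebesgue_measure R).

Lemma der_le0_le (f f' : R -> R) (a b : R) : a <= b ->
  (forall x, a <= x <= b -> is_derive x 1 f (f' x)) ->
  (forall x, a <= x <= b -> f' x <= 0) -> f b <= f a.
Proof.
move=> ab df f'0.
have [||c cab E] := @MVT_segment _ f f' a b ab.
- by move=> x; rewrite in_itv/= => /andP[ax xb]; apply: df; rewrite !ltW.
- by apply: within_continuous_itv => x /df/der_continuous.
rewrite -subr_le0 E; apply: mulr_le0_ge0; last by rewrite subr_ge0.
by apply: f'0; move: cab; rewrite in_itv.
Qed.

Lemma norm_le_1Dsqr (x E : R) : x ^+ 2 <= E -> `|x| <= 1 + E.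
Proof.
move=> xE; have : 0 <= (`|x| - 1) ^+ 2 by exact: sqr_ge0.
have : `|x| ^+ 2 = x ^+ 2 by rewrite real_normK// num_real.
have : 0 <= x ^+ 2 by exact: sqr_ge0.
by nra.
Qed.

(** The function w = s^m B solves w'' + w = c w / s^2 with c = m (m - 1). The
    energy w^2 + w'^2 then has logarithmic derivative at most |c| / s^2, which
    is integrable at infinity, so w and w' are bounded. Variation of constants
    for w'' + w gives p and q: their derivatives are c w / s^2 times cos s
    and - sin s. *)
Lemma bessel_amplitude (m : R) (B B1 B2 : R -> R) :
  (forall s : R, is_derive s 1 B (B1 s)) ->
  (forall s : R, is_derive s 1 B1 (B2 s)) ->
  (forall s, 0 < s -> B2 s + 2 * m / s * B1 s + B s = 0) ->
  exists p p' q q' : R -> R, exists2 K : R, 0 <= K &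
  [/\ forall s : R, 0 < s -> is_derive s 1 p (p' s),
      forall s : R, 0 < s -> is_derive s 1 q (q' s),
      forall s, 0 < s -> s `^ m * B s = p s * sin s + q s * cos s,
      forall s, 1 <= s -> `|p s| <= K /\ `|p' s| <= K * s ^- 2 &
      forall s, 1 <= s -> `|q s| <= K /\ `|q' s| <= K * s ^- 2].
Proof.
move=> dB dB1 ode.
pose w s := s `^ m * B s.
pose w1 s := s `^ m * (m / s * B s + B1 s).
pose c := m * (m - 1).
have dw (s : R) : 0 < s -> is_derive s 1 w (w1 s).
  move=> s0; have dBs := dB s; rewrite /w; eapply der_eq; first by der.
  by rewrite /= /w1 powRB1//; field; rewrite gt_eqF.
have dw1 (s : R) : 0 < s -> is_derive s 1 w1 (c * w s / s ^+ 2 - w s).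
  move=> s0; have dBs := dB s; have dB1s := dB1 s.
  have B2E : B2 s = - (2 * m / s * B1 s) - B s by have := ode s s0; lra.
  rewrite /w1; eapply der_eq; first by der; rewrite gt_eqF.
  by rewrite /= /w B2E powRB1// /c; field; rewrite gt_eqF.
pose E s := w s ^+ 2 + w1 s ^+ 2.
pose E0 := E 1 * expR `|c|.
have EE s : 1 <= s -> E s <= E0.
  move=> s1.
  have s0 : 0 < s by exact: lt_le_trans s1.
  (* |c| / x is a primitive of - |c| / x^2 : the product decreases *)
pose F x := E x * expR (`|c| / x).
  pose F' x := expR (`|c| / x) *
    (2 * c * w x * w1 x / x ^+ 2 - `|c| * E x / x ^+ 2).
  have FF : F s <= F 1.
    apply: (@der_le0_le F F') => //.
      move=> x /andP[x1 _]; have x0 : 0 < x by exact: lt_le_trans x1.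
      have dwx := dw x x0; have dw1x := dw1 x x0.
      rewrite /F /E; eapply der_eq; first by der; rewrite gt_eqF.
      by rewrite /= /F' /E; field; rewrite gt_eqF.
    move=> x /andP[x1 _]; rewrite /F'; apply: mulr_ge0_le0; first exact: expR_ge0.
    rewrite -mulrBl; apply: mulr_le0_ge0; last by rewrite invr_ge0 exprn_ge0// (le_trans _ x1).
    rewrite subr_le0; apply: le_trans (ler_norm _) _.
    have -> : 2 * c * w x * w1 x = c * (2 * w x * w1 x) by ring.
    rewrite normrM ler_wpM2l// [`|_ * w1 x|]normrM [`|2 * w x|]normrM (ger0_norm (ler0n _ _)).
    have : 0 <= (`|w x| - `|w1 x|) ^+ 2 by exact: sqr_ge0.
    have : `|w x| ^+ 2 = w x ^+ 2 by rewrite real_normK// num_real.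
    have : `|w1 x| ^+ 2 = w1 x ^+ 2 by rewrite real_normK// num_real.
    rewrite /E => <- <-; rewrite sqrrB -mulr_natl => H3. lra.
  rewrite /F divr1 in FF; apply: le_trans FF.
  rewrite ler_peMr ?addr_ge0 ?sqr_ge0//.
  by rewrite -expR0 ler_expR divr_ge0// ltW.
have E00 : 0 <= E0 by rewrite mulr_ge0 ?expR_ge0// addr_ge0 ?sqr_ge0.
have wE s : 1 <= s -> `|w s| <= 1 + E0.
  move=> /EE H; apply: norm_le_1Dsqr; apply: le_trans H.
  by rewrite lerDl sqr_ge0.
have w1E s : 1 <= s -> `|w1 s| <= 1 + E0.
  move=> /EE H; apply: norm_le_1Dsqr; apply: le_trans H.
  by rewrite lerDr sqr_ge0.
pose p s := cos s * w1 s + sin s * w s.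
pose q s := cos s * w s - sin s * w1 s.
exists p, (fun s => cos s * (c * w s / s ^+ 2)), q, (fun s => - (sin s * (c * w s / s ^+ 2))).
pose K := (1 + E0) * (2 + `|c|).
have le1 s (x : R) : 1 <= s -> `|x| <= 1 -> `|x * (c * w s / s ^+ 2)| <= K * s ^- 2.
  move=> s1 x1; rewrite mulrC; apply: normrM_le1 => //.
  rewrite normrM [`|_^-1|]ger0_norm; last by rewrite invr_ge0 exprn_ge0// (le_trans _ s1).
  rewrite ler_wpM2r//; first by rewrite invr_ge0 exprn_ge0// (le_trans _ s1).
  rewrite normrM mulrC ler_pM// ?wE// lerDr//.
have le2 s (x y : R) : 1 <= s -> `|x| <= 1 -> `|y| <= 1 ->
    `|x * w1 s| <= 1 + E0 /\ `|y * w s| <= 1 + E0.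
  move=> s1 x1 y1; split; rewrite mulrC; apply: normrM_le1 => //; [exact: w1E|exact: wE].
have KE : (1 + E0) + (1 + E0) <= K.
  have : 0 <= (1 + E0) * `|c| by rewrite mulr_ge0// addr_ge0.
  by rewrite /K; lra.
exists K; first by rewrite mulr_ge0 ?addr_ge0.
split.
- move=> s s0; have dws := dw s s0; have dw1s := dw1 s s0.
  rewrite /p; eapply der_eq; first by der.
  by rewrite /=; ring.
- move=> s s0; have dws := dw s s0; have dw1s := dw1 s s0.
  rewrite /q; eapply der_eq; first by der.
  by rewrite /=; ring.
- move=> s s0; rewrite -/(w s) /p /q.
  have -> : (cos s * w1 s + sin s * w s) * sin s + (cos s * w s - sin s * w1 s) * cos s
    = (cos s ^+ 2 + sin s ^+ 2) * w s by ring.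
  by rewrite cos2Dsin2 mul1r.
- move=> s s1; split; last by apply: le1 => //; exact: normr_cos_le1.
  have [H1 H2] := le2 s _ _ s1 (normr_cos_le1 s) (normr_sin_le1 s).
  by apply: le_trans (ler_normD _ _) _; lra.
- move=> s s1; split; last by rewrite normrN; apply: le1 => //; exact: normr_sin_le1.
  have [H1 H2] := le2 s _ _ s1 (normr_sin_le1 s) (normr_cos_le1 s).
  by apply: le_trans (ler_normB _ _) _; lra.
Qed.

(** For r <= 1 / X the bound on B suffices. For r >= 1 / X the factor
    r^(m-1) B(rX) is X^(-m) r^(-1) (p(rX) sin(rX) + q(rX) cos(rX)), and the
    product formulas for cosines and sines give four integrals of the kind of
    [osc_log_amplitude], with frequencies l + X and l - X. *)
Lemma osc_bessel (m V : R) (psi psi' B B1 B2 : R -> R) : 0 < m ->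
  (forall x : R, is_derive x 1 psi (psi' x)) -> continuous psi' ->
  (forall s : R, is_derive s 1 B (B1 s)) ->
  (forall s : R, is_derive s 1 B1 (B2 s)) ->
  (forall s, 0 < s -> B2 s + 2 * m / s * B1 s + B s = 0) ->
  (forall s, `|B s| <= V) ->
  exists2 C : R, 0 <= C & forall ka al l X : R, 0 < X ->
    `|\int[mu]_(r in `]0, 1])
        (r `^ (m - 1) * (ka * (psi r * cos (phase ka l al r) * B (r * X))))| <=
    C * (1 + `|ka|) ^+ 2 * X `^ (- m).
Proof.
move=> m0 dpsi cpsi' dB dB1 ode BV.
have [p [p' [q [q' [K K0 [dp dq wE pK qK]]]]]] := bessel_amplitude dB dB1 ode.
have cpsi : continuous psi by move=> x; exact: der_continuous (dpsi x).
have cB : continuous B by move=> x; exact: der_continuous (dB x).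
have [A A0 psiA] := continuous_bounded_itv 0 1 cpsi.
have [A' A'0 psiA'] := continuous_bounded_itv 0 1 cpsi'.
have V0 : 0 <= V by exact: le_trans (BV 0).
(* bounds twice the supremum plus the variation on [1 / X, 1] of psi(r) p(rX) *)
pose D := 2 * (A * K) + A' * K + A * K.
have D0 : 0 <= D by rewrite !addr_ge0 ?mulr_ge0.
exists (A * V / m + 12 * D).
  by rewrite addr_ge0 ?mulr_ge0 ?invr_ge0 ?(ltW m0).
move=> ka al l X X0.
pose g r := ka * (psi r * cos (phase ka l al r) * B (r * X)).
have mg : measurable_fun [set: R] g.
  apply: measurable_funM => //; apply: measurable_funM.
    apply: measurable_funM; first exact: continuous_measurable_fun.
    exact: measurable_phase_cos.
  apply: measurableT_comp; first exact: continuous_measurable_fun.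
  exact: measurable_funM.
have gK r : 0 < r <= 1 -> `|g r| <= `|ka| * (A * V).
  move=> /andP[r0 r1]; rewrite normrM ler_wpM2l// normrM ler_pM//.
  apply: normrM_le1; last exact: normr_cos_le1.
  by apply: psiA; rewrite r1 ltW.
have k0 : 0 <= `|ka| by [].
have [X1|X1] := leP X 1.
  apply: le_trans (Rintegral_powR_le ltr01 m0 mg gK) _.
  have L1 : 1 <= X `^ (- m).
    rewrite powRN invf_ge1 ?powR_gt0//.
    have : X `^ m <= 1 `^ m by rewrite ge0_ler_powR ?nnegrE// ltW.
    by rewrite powR1.
  rewrite powR1 mul1r.
  have e1 : 0 <= A * V / m by rewrite mulr_ge0 ?mulr_ge0 ?invr_ge0 ?(ltW m0).
  apply: (@le_trans _ _ ((A * V / m + 12 * D) * (1 + `|ka|) ^+ 2)); last first.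
    by rewrite ler_peMr// mulr_ge0 ?exprn_ge0 ?addr_ge0// mulr_ge0.
  have -> : `|ka| * (A * V) / m = A * V / m * `|ka| by ring.
  apply: ler_pM => //; first by rewrite lerDl mulr_ge0.
  nra.
pose a := X^-1.
have a0 : 0 < a by rewrite invr_gt0.
have a1 : a <= 1 by rewrite invf_le1// ltW.
have aE : a `^ m = X `^ (- m) by rewrite /a -powR_inv1 ?ltW// -powRrM mulN1r.
rewrite (@Rintegral_oc_split _ _ a 1) ?a0//; last exact: (integrable_powR ltr01 m0 mg gK).
apply: le_trans (ler_normD _ _) _.
have I1 : `|\int[mu]_(r in `]0, a]) (r `^ (m - 1) * g r)| <=
    `|ka| * (A * V) * (a `^ m / m).
  apply: (Rintegral_powR_le a0 m0 mg) => r /andP[r0 ra].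
  by apply: gK; rewrite r0 (le_trans ra).
pose T l al r := ka * (r^-1 * cos (phase ka l al r)).
pose f1 r := T (l + X) (al - pi / 2) r * (psi r * p (r * X)).
pose f2 r := T (l - X) (al - pi / 2) r * (psi r * p (r * X)).
pose f3 r := T (l + X) al r * (psi r * q (r * X)).
pose f4 r := T (l - X) al r * (psi r * q (r * X)).
have pr (r : R) : a <= r <= 1 -> 0 < r by move=> /andP[ar _]; exact: lt_le_trans ar.
have rX1 (r : R) : a <= r <= 1 -> 1 <= r * X.
  by move=> /andP[ar _]; rewrite -ler_pdivrMr// div1r.
have dcomp (h h' : R -> R) (r : R) : (forall s : R, 0 < s -> is_derive s 1 h (h' s)) ->
    0 < r -> is_derive r 1 (fun r => psi r * h (r * X))
      (psi' r * h (r * X) + psi r * (h' (r * X) * X)).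
  move=> dh r0; have dpsir := dpsi r.
  have dhr : is_derive r 1 (fun r => h (r * X)) (h' (r * X) * X).
    apply: der_comp; first by apply: dh; rewrite mulr_gt0.
    by eapply der_eq; [der|rewrite /= mul1r mulr0 addr0].
  exact: der_mul.
have cT l' al' (h h' : R -> R) r : (forall s : R, 0 < s -> is_derive s 1 h (h' s)) ->
    a <= r <= 1 -> {for r, continuous (fun r => T l' al' r * (psi r * h (r * X)))}.
  move=> dh /pr r0; apply: continuous_mul_at; last first.
    exact: der_continuous (dcomp _ _ _ dh r0).
  have dph := der_phase ka l' al' r0.
  by eapply der_continuous; der; rewrite gt_eqF.
have bd l' al' (h h' : R -> R) : (forall s : R, 0 < s -> is_derive s 1 h (h' s)) ->
    (forall s, 1 <= s -> `|h s| <= K /\ `|h' s| <= K * s ^- 2) ->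
    `|\int[mu]_(r in `[a, 1]) (T l' al' r * (psi r * h (r * X)))| <=
    6 * (1 + `|ka|) ^+ 2 * D.
  move=> dh hK.
  have H := @osc_log_amplitude _ ka l' al' _ _
    (fun r => A' * K * r - A * K / X / r) (fun r => A' * K + A * K / X * r ^- 2)
    (A * K) a 1 _ (fun r => @dcomp h h' r dh).
  apply: le_trans (H _ _ _ _) _.
  - by rewrite a0.
  - move=> r r0; eapply der_eq; first by der; rewrite gt_eqF.
    by rewrite /=; field; rewrite !gt_eqF.
  - move=> r r1; have [h1 h2] := hK _ (rX1 r r1); have r0 := pr r r1.
    have /andP[_ r11] := r1.
    apply: le_trans (ler_normD _ _) _; apply: lerD.
      by rewrite normrM ler_pM// psiA'// r11 ltW.
    rewrite normrM -2!mulrA; apply: ler_pM => //; first by apply: psiA; rewrite r11 ltW.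
    rewrite normrM (gtr0_norm X0).
    apply: (@le_trans _ _ (K * (r * X) ^- 2 * X)); first by rewrite ler_wpM2r// ltW.
    rewrite le_eqVlt; apply/orP; left; apply/eqP; field.
    by rewrite !gt_eqF.
  - move=> r r1; have [h1 h2] := hK _ (rX1 r r1); have r0 := pr r r1.
    have /andP[_ r11] := r1.
    by rewrite normrM ler_pM// psiA// r11 ltW.
  rewrite ler_wpM2l ?mulr_ge0 ?exprn_ge0 ?addr_ge0//.
  have -> : A * K / X / a = A * K by rewrite /a invrK divfK// gt_eqF.
  have : 0 <= A * K / X / 1 by rewrite !divr_ge0 ?mulr_ge0 ?(ltW X0).
  have : 0 <= A' * K * a by rewrite !mulr_ge0 ?(ltW a0).
  by rewrite /D; lra.
have I2 : \int[mu]_(r in `[a, 1]) (r `^ (m - 1) * g r) =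
   X `^ (- m) / 2 * (\int[mu]_(r in `[a, 1]) f1 r - \int[mu]_(r in `[a, 1]) f2 r +
   (\int[mu]_(r in `[a, 1]) f3 r + \int[mu]_(r in `[a, 1]) f4 r)).
  have c1 := fun r => @cT (l + X) (al - pi / 2) p p' r dp.
  have c2 := fun r => @cT (l - X) (al - pi / 2) p p' r dp.
  have c3 := fun r => @cT (l + X) al q q' r dq.
  have c4 := fun r => @cT (l - X) al q q' r dq.
  rewrite -RintegralB//; [|exact: continuous_integrable..].
  rewrite -RintegralD//; [|exact: continuous_integrable..].
  have c12 r : a <= r <= 1 -> {for r, continuous (fun r => f1 r - f2 r)}.
    by move=> r1; apply: cvgB; [exact: c1|exact: c2].
  have c34 r : a <= r <= 1 -> {for r, continuous (fun r => f3 r + f4 r)}.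
    by move=> r1; apply: cvgD; [exact: c3|exact: c4].
  rewrite -RintegralD//; [|exact: continuous_integrable..].
  rewrite -RintegralZl//; last first.
    apply: continuous_integrable => r r1.
    by apply: cvgD; [exact: c12|exact: c34].
  apply: eq_Rintegral => r; rewrite inE/= in_itv/= => /pr r0.
  have rX0 : 0 < r * X by rewrite mulr_gt0.
  have := wE _ rX0; rewrite powRM ?ltW// => w.
  rewrite powRN /g /f1 /f2 /f3 /f4 /T !phaseBpihalf.
  have ph e : phase ka (l + e) al r = phase ka l al r + r * e.
    by rewrite /phase; ring.
  rewrite !ph mulrN !sinD !cosD sinN cosN.
  have Xm : X `^ m != 0 by rewrite gt_eqF// powR_gt0.
  have rn0 : r != 0 by rewrite gt_eqF.
  have BE : B (r * X) = (p (r * X) * sin (r * X) + q (r * X) * cos (r * X)) /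
     (r `^ m * X `^ m).
    by rewrite -w mulrAC divff ?mul1r// mulf_neq0// gt_eqF// powR_gt0.
  have rm : r `^ m != 0 by rewrite gt_eqF// powR_gt0.
  rewrite BE powRB1//; field.
  by rewrite rm Xm rn0.
rewrite I2.
have h1 := bd (l + X) (al - pi / 2) p p' dp pK.
have h2 := bd (l - X) (al - pi / 2) p p' dp pK.
have h3 := bd (l + X) al q q' dq qK.
have h4 := bd (l - X) al q q' dq qK.
set S := 6 * (1 + `|ka|) ^+ 2 * D in h1 h2 h3 h4.
have H4 (x y z t : R) : `|x| <= S -> `|y| <= S -> `|z| <= S -> `|t| <= S ->
    `|x - y + (z + t)| <= 4 * S.
  move=> hx hy hz ht; apply: le_trans (ler_normD _ _) _.
  have := ler_normB x y; have := ler_normD z t; lra.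
have H5 := H4 _ _ _ _ h1 h2 h3 h4.
rewrite [`|X `^ (- m) / 2 * _|]normrM (ger0_norm (divr_ge0 (powR_ge0 _ _) (ler0n _ 2))).
have Xm0 : 0 <= X `^ (- m) / 2 by rewrite divr_ge0 ?powR_ge0.
apply: le_trans (lerD I1 (ler_wpM2l Xm0 H5)) _.
rewrite aE /S.
set u := X `^ (- m); set y := `|ka| in k0 *.
have u0 : 0 <= u by exact: powR_ge0.
have -> : y * (A * V) * (u / m) + u / 2 * (4 * (6 * (1 + y) ^+ 2 * D)) =
  (A * V / m * y + 12 * D * (1 + y) ^+ 2) * u.
  by field; rewrite gt_eqF.
rewrite ler_wpM2r// [leRHS]mulrDl lerD2r ler_wpM2l//; last by nra.
by rewrite mulr_ge0 ?mulr_ge0 ?invr_ge0 ?(ltW m0).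
Qed.

End bessel.

(** * Integrals over directions *)

Section sphere.
Context {R : realType}.
Local Notation leb := (@lebesgue_tuple R).
Variable n : nat.
Local Notation T := (n.+1.-tuple R).
Local Notation S := (@punctured_ball R n.+1).

Lemma bounded_integrable_ball (f : T -> R) (K : R) : measurable_fun setT f ->
  (forall v, S v -> `|f v| <= K) -> (leb n.+1).-integrable S (EFin \o f).
Proof.
move=> mf fK; apply: measurable_bounded_integrable.
- exact: measurable_punctured_ball.
- exact: lebesgue_tuple_punctured_ball_lty.
- exact: measurable_funTS.
- exists K; split; first exact: num_real.
  by move=> x Kx v Sv; apply: le_trans (ltW Kx); exact: fK.
Qed.

Lemma der_under_integral_ball (f f' : R -> T -> R) (K K' : R) (a : R) :
  (forall x, measurable_fun setT (f x)) ->
  (forall x v, S v -> `|f x v| <= K) ->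
  (forall x v, is_derive x (1 : R) (fun y => f y v) (f' x v)) ->
  (forall x v, S v -> `|f' x v| <= K') ->
  is_derive a (1 : R) (fun x => \int[leb n.+1]_(v in S) f x v)
    (\int[leb n.+1]_(v in S) f' a v).
Proof.
move=> mf fK df f'K.
have intf (x : R) : `]a - 1, a + 1[%classic x ->
    (leb n.+1).-integrable S (EFin \o f x).
  by move=> _; exact: bounded_integrable_ball (mf x) (fK x).
have Ia : `]a - 1, a + 1[%classic a by rewrite /= in_itv/= gtrBl ltrDl ltr01.
have derf (x : R) v : `]a - 1, a + 1[%classic x -> S v -> derivable (f ^~ v) x 1.
  by move=> _ _; exact: der_derivable (df x v).
have parE x v : partial1of2 f x v = f' x v.
  by rewrite partial1of2E; have [_ ->] := df x v.
have G0 (v : T) : 0 <= `|K'| by [].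
have intG : (leb n.+1).-integrable S (EFin \o (fun=> `|K'|)).
  by apply: bounded_integrable_ball => // v _; exact: lexx.
have Gub (x : R) v : `]a - 1, a + 1[%classic x -> S v -> `|partial1of2 f x v| <= `|K'|.
  by move=> _ Sv; rewrite parE; apply: le_trans (f'K x v Sv) (ler_norm _).
have mS := @measurable_punctured_ball R n.+1.
have D := derivable_under_integral mS Ia intf derf G0 intG Gub.
have E := differentiation_under_integral mS Ia intf derf G0 intG Gub.
apply: DeriveDef; first exact: D.
by rewrite -derive1E E; apply: eq_Rintegral => v _; exact: parE.
Qed.

Lemma dot_direction_self (v : T) : S v -> dot (direction v) (direction v) = 1.
Proof.
move=> /andP[v0 _]; rewrite /direction dot_scaler dot_scalel.
have -> : dot v v = enorm v ^+ 2 by rewrite sqr_sqrtr// dot_ge0.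
by field; rewrite gt_eqF.
Qed.

Lemma norm_tnth_direction (v : T) i : S v -> `|tnth (direction v) i| <= 1.
Proof.
move=> Sv; rewrite -sqrtr_sqr -[leRHS]sqrtr1 ler_sqrt// -(dot_direction_self Sv).
rewrite /dot (bigD1 i)//= expr2 lerDl sumr_ge0// => j _.
by rewrite -expr2 sqr_ge0.
Qed.

(** An integral of cos(x.w + al) over the unit sphere, in the normalisation for
    which the sphere has the volume of the unit ball. *)
Definition sphere_integral (x : T) (al : R) : R :=
  \int[leb n.+1]_(v in S) cos (dot x (direction v) + al).

Lemma measurable_sphere_cos (x : T) (al : R) :
  measurable_fun setT (fun v : T => cos (dot x (direction v) + al)).
Proof.
apply: measurableT_comp; first by apply: continuous_measurable_fun; exact: continuous_cos.
apply: measurable_funD => //; apply: measurableT_comp; first exact: measurable_dot.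
exact: measurable_direction.
Qed.

Lemma sphere_integral_le (x : T) (al : R) : `|sphere_integral x al| <= fine (leb n.+1 S).
Proof.
have fi := bounded_integrable_ball (measurable_sphere_cos x al) (fun v _ => normr_cos_le1 _).
apply: le_trans (le_normr_Rintegral (@measurable_punctured_ball R n.+1) fi) _.
rewrite -[leRHS]mul1r -Rintegral_cst; last exact: measurable_punctured_ball.
apply: le_Rintegral.
- exact: measurable_punctured_ball.
- exact: integrable_norm fi.
- apply: (@bounded_integrable_ball _ 1) => // v _; by rewrite normr1.
by move=> v _; exact: normr_cos_le1.
Qed.

(** Rotation invariance is available for nonnegative integrands, and 1 + cos is
    one. *)
Lemma sphere_integral_rot (x y : T) (al : R) : enorm x = enorm y ->
  sphere_integral x al = sphere_integral y al.
Proof.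
move=> xy.
pose I01 : set R := `]0, 1]%classic.
pose F (p q : R) : \bar R :=
  (\1_I01 (Num.sqrt q) * (1 + cos ((Num.sqrt q)^-1 * p + al)))%:E.
have F0 p q : (0 <= F p q)%E.
  by rewrite lee_fin mulr_ge0// -lerBlDl sub0r cos_geN1.
have mF : measurable_fun setT (fun p : R * R => F p.1 p.2).
  have ms : measurable_fun setT (fun p : R * R => Num.sqrt p.2).
    by apply: measurableT_comp => //; exact: measurable_sqrtr.
  have mI : measurable_fun [set: R] (\1_I01 : R -> R).
    by apply: measurable_indic; exact: measurable_itv.
  apply/measurable_EFinP; apply: measurable_funM.
    exact: (measurableT_comp mI ms).
  apply: measurable_funD => //.
  apply: measurableT_comp; first by apply: continuous_measurable_fun; exact: continuous_cos.
  apply: measurable_funD => //; apply: measurable_funM => //.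
  by apply: measurableT_comp => //; exact: measurable_invr.
have FE z : (\int[leb n.+1]_v F (dot z v) (dot v v) =
    (fine (leb n.+1 S) + sphere_integral z al)%:E)%E.
  have fi := bounded_integrable_ball (measurable_sphere_cos z al) (fun v _ => normr_cos_le1 _).
  have ci : (leb n.+1).-integrable S (EFin \o (fun=> 1 : R)).
    by apply: (@bounded_integrable_ball _ 1) => // v _; rewrite normr1.
  rewrite EFinD -[X in (X%:E + _)%E]mul1r -Rintegral_cst; last exact: measurable_punctured_ball.
  rewrite -EFinD /sphere_integral -RintegralD//; last exact: measurable_punctured_ball.
  rewrite /Rintegral fineK; last first.
    apply: integrable_fin_num; first exact: measurable_punctured_ball.
    apply: (@bounded_integrable_ball (fun v => 1 + cos (dot z (direction v) + al)) 2).
      by apply: measurable_funD => //; exact: measurable_sphere_cos.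
    move=> v _; apply: le_trans (ler_normD _ _) _.
    by have := normr_cos_le1 (dot z (direction v) + al); rewrite normr1; lra.
  rewrite [RHS]integral_mkcond; apply: eq_integral => v _.
  rewrite /F patchE -/(enorm v) -dot_scaler -/(direction v) indicE.
  have -> : (enorm v \in I01) = (v \in S).
    by rewrite mem_punctured_ball; apply/idP/idP; rewrite inE /I01 /= in_itv.
  by case: ifPn => _; rewrite ?mul1r ?mul0r.
have := ge0_integral_rotationE mF F0 xy.
by rewrite !FE => -[] /addrI.
Qed.

End sphere.

(** * Bessel's equation for the Fourier transform of the sphere *)

Section sphere_ode.
Context {R : realType}.
Local Notation leb := (@lebesgue_tuple R).
Variable n : nat.
Local Notation T := (n.+1.-tuple R).
Local Notation S := (@punctured_ball R n.+1).

Definition vec2 (a b : R) (k : 'I_n.+1) : T :=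
  mktuple (fun i => a * (i == ord0)%:R + b * (i == k)%:R).

Lemma dot_vec2 a b k (v : T) : dot (vec2 a b k) v = a * tnth v ord0 + b * tnth v k.
Proof.
rewrite /dot; under eq_bigr do rewrite tnth_mktuple mulrDl -!mulrA.
rewrite big_split -!mulr_sumr; congr (_ * _ + _ * _).
- by rewrite (bigD1 ord0)//= ?eqxx mul1r big1 ?addr0// => i /negbTE ->; rewrite mul0r.
- by rewrite (bigD1 k)//= ?eqxx mul1r big1 ?addr0// => i /negbTE ->; rewrite mul0r.
Qed.

Lemma enorm_vec2 a b k : k != ord0 -> enorm (vec2 a b k) = Num.sqrt (a ^+ 2 + b ^+ 2).
Proof.
move=> k0; rewrite /enorm dot_vec2 !tnth_mktuple eqxx (negbTE k0) eq_sym (negbTE k0) eqxx.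
by congr Num.sqrt; rewrite /= ?mulr1n ?mulr0n; ring.
Qed.

Definition axis (s : R) : T := vec2 s 0 ord0.

Lemma enorm_axis s : enorm (axis s) = `|s|.
Proof.
rewrite /enorm /axis dot_vec2 tnth_mktuple eqxx.
by rewrite -sqrtr_sqr; congr Num.sqrt; rewrite /= ?mulr1n ?mulr0n; ring.
Qed.

Lemma measurable_coord k : measurable_fun setT (fun v : T => tnth (direction v) k).
Proof. exact: (measurableT_comp (measurable_tnth k) (@measurable_direction R n.+1)). Qed.

Lemma measurable_cosT d (X : measurableType d) (f : X -> R) :
  measurable_fun setT f -> measurable_fun setT (fun x => cos (f x)).
Proof.
by apply: measurableT_comp; apply: continuous_measurable_fun; exact: continuous_cos.
Qed.

Lemma measurable_sinT d (X : measurableType d) (f : X -> R) :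
  measurable_fun setT f -> measurable_fun setT (fun x => sin (f x)).
Proof.
by apply: measurableT_comp; apply: continuous_measurable_fun; exact: continuous_sin.
Qed.

Let u (v : T) := tnth (direction v) ord0.
Let measurable_u : measurable_fun setT u. Proof. exact: measurable_coord. Qed.
Let u1 v : S v -> `|u v| <= 1. Proof. exact: norm_tnth_direction. Qed.

(** The Fourier transform of the sphere along the first axis, followed by its
    first two derivatives. *)
Definition sphere_ft (s : R) : R := sphere_integral (axis s) 0.
Definition sphere_ft1 (s : R) : R := \int[leb n.+1]_(v in S) (- (u v * sin (s * u v))).
Definition sphere_ft2 (s : R) : R :=
  \int[leb n.+1]_(v in S) (- (u v ^+ 2 * cos (s * u v))).

Lemma sphere_ftE s : sphere_ft s = \int[leb n.+1]_(v in S) cos (s * u v).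
Proof.
by apply: eq_Rintegral => v _; rewrite dot_vec2 mul0r !addr0.
Qed.

Lemma der_sphere_ft (s : R) : is_derive s 1 sphere_ft (sphere_ft1 s).
Proof.
have -> : sphere_ft = fun s => \int[leb n.+1]_(v in S) cos (s * u v).
  by apply/funext => x; exact: sphere_ftE.
apply: (@der_under_integral_ball _ _ _ (fun s v => - (u v * sin (s * u v))) 1 1).
- by move=> x; apply: measurable_cosT; exact: measurable_funM.
- by move=> x v _; exact: normr_cos_le1.
- move=> x v; eapply der_eq; first by der.
  by rewrite /=; ring.
- by move=> x v /u1 uv; rewrite normrN; apply: normrM_le1 => //; exact: normr_sin_le1.
Qed.

Lemma der_sphere_ft1 (s : R) : is_derive s 1 sphere_ft1 (sphere_ft2 s).
Proof.
apply: (@der_under_integral_ball _ _ (fun s v => - (u v * sin (s * u v)))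
  (fun s v => - (u v ^+ 2 * cos (s * u v))) 1 1).
- move=> x; apply: measurableT_comp => //; apply: measurable_funM => //.
  by apply: measurable_sinT; exact: measurable_funM.
- by move=> x v /u1 uv; rewrite normrN; apply: normrM_le1 => //; exact: normr_sin_le1.
- move=> x v; eapply der_eq; first by der.
  by rewrite /=; ring.
- move=> x v /u1 uv; rewrite normrN; apply: normrM_le1; last exact: normr_cos_le1.
  by rewrite expr2; exact: normrM_le1.
Qed.

Lemma is_derive_unique (f : R -> R) (x a b : R) :
  is_derive x 1 f a -> is_derive x 1 f b -> a = b.
Proof. by move=> [_ <-] [_ <-]. Qed.

(** Let a turn in the plane of the first and k-th axes. By rotation invariance
    the integral of cos(s a.w) does not depend on the angle y of a, and the
    identity is the vanishing of its second derivative at y = 0. *)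
Lemma sphere_tangential (s : R) (k : 'I_n.+1) : k != ord0 -> s != 0 ->
  \int[leb n.+1]_(v in S) (u v * sin (s * u v)) =
  s * \int[leb n.+1]_(v in S) (tnth (direction v) k ^+ 2 * cos (s * u v)).
Proof.
move=> k0 s0.
pose w (v : T) := tnth (direction v) k.
have mw : measurable_fun setT w by exact: measurable_coord.
have w1 v : S v -> `|w v| <= 1 by exact: norm_tnth_direction.
pose ph (y : R) v := s * cos y * u v + s * sin y * w v.
pose ph1 (y : R) v := - (s * sin y) * u v + s * cos y * w v.
pose f0 (y : R) v := cos (ph y v).
pose f1 (y : R) v := - (sin (ph y v) * ph1 y v).
pose f2 (y : R) v := sin (ph y v) * ph y v - cos (ph y v) * ph1 y v ^+ 2.
have mph y : measurable_fun setT (ph y).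
  by apply: measurable_funD; exact: measurable_funM.
have mph1 y : measurable_fun setT (ph1 y).
  by apply: measurable_funD; exact: measurable_funM.
have scx (x y : R) : `|y| <= 1 -> `|s * x| <= `|s| -> `|s * x * y| <= `|s|.
  by move=> y1 sx; apply: normrM_le1.
have phb y v : S v -> `|ph y v| <= 2 * `|s|.
  move=> Sv; apply: le_trans (ler_normD _ _) _.
  have H1 : `|s * cos y * u v| <= `|s|.
    by apply: scx; [exact: u1|apply: normrM_le1 => //; exact: normr_cos_le1].
  have H2 : `|s * sin y * w v| <= `|s|.
    by apply: scx; [exact: w1|apply: normrM_le1 => //; exact: normr_sin_le1].
  lra.
have ph1b y v : S v -> `|ph1 y v| <= 2 * `|s|.
  move=> Sv; apply: le_trans (ler_normD _ _) _.
  have H1 : `|- (s * sin y) * u v| <= `|s|.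
    rewrite mulNr normrN.
    by apply: scx; [exact: u1|apply: normrM_le1 => //; exact: normr_sin_le1].
  have H2 : `|s * cos y * w v| <= `|s|.
    by apply: scx; [exact: w1|apply: normrM_le1 => //; exact: normr_cos_le1].
  lra.
have s2 : 0 <= 2 * `|s| by rewrite mulr_ge0.
have d0 y : is_derive y (1 : R) (fun y => \int[leb n.+1]_(v in S) f0 y v)
    (\int[leb n.+1]_(v in S) f1 y v).
  apply: (@der_under_integral_ball _ _ f0 f1 1 (2 * `|s|)).
  - by move=> x; exact: measurable_cosT.
  - by move=> x v _; exact: normr_cos_le1.
  - move=> x v; rewrite /f0 /ph; eapply der_eq; first by der.
    by rewrite /= /f1 /ph /ph1; ring.
  - move=> x v Sv; rewrite normrN mulrC; apply: normrM_le1; first exact: ph1b.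
    exact: normr_sin_le1.
have d1 y : is_derive y (1 : R) (fun y => \int[leb n.+1]_(v in S) f1 y v)
    (\int[leb n.+1]_(v in S) f2 y v).
  apply: (@der_under_integral_ball _ _ f1 f2 (2 * `|s|) (2 * `|s| + (2 * `|s|) ^+ 2)).
  - move=> x; apply: measurableT_comp => //; apply: measurable_funM => //.
    exact: measurable_sinT.
  - move=> x v Sv; rewrite normrN mulrC; apply: normrM_le1; first exact: ph1b.
    exact: normr_sin_le1.
  - move=> x v; rewrite /f1 /ph1 /ph; eapply der_eq; first by der.
    by rewrite /= /f2 /ph /ph1; ring.
  - move=> x v Sv; apply: le_trans (ler_normB _ _) _; apply: lerD.
      by rewrite mulrC; apply: normrM_le1; [exact: phb|exact: normr_sin_le1].
    rewrite mulrC; apply: normrM_le1; last exact: normr_cos_le1.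
    by rewrite normrX lerXn2r ?nnegrE// ph1b.
have f1_0 y : \int[leb n.+1]_(v in S) f1 y v = 0.
  apply: (is_derive_unique (d0 y)).
  have -> : (fun y => \int[leb n.+1]_(v in S) f0 y v) = fun=> sphere_ft s.
    apply/funext => z; transitivity (sphere_integral (vec2 (s * cos z) (s * sin z) k) 0).
      by apply: eq_Rintegral => v _; rewrite dot_vec2 addr0.
    apply: sphere_integral_rot; rewrite enorm_vec2// enorm_axis -sqrtr_sqr; congr Num.sqrt.
    by rewrite !exprMn -mulrDr cos2Dsin2 mulr1.
  exact: der_cst.
have f2_0 : \int[leb n.+1]_(v in S) f2 0 v = 0.
  apply: (is_derive_unique (d1 0)).
  have -> : (fun y => \int[leb n.+1]_(v in S) f1 y v) = fun=> 0.
    by apply/funext => z; exact: f1_0.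
  exact: der_cst.
have mS := @measurable_punctured_ball R n.+1.
have i1 : (leb n.+1).-integrable S (EFin \o (fun v => u v * sin (s * u v))).
  apply: (@bounded_integrable_ball _ _ _ 1).
    by apply: measurable_funM => //; apply: measurable_sinT; exact: measurable_funM.
  by move=> v /u1 uv; apply: normrM_le1 => //; exact: normr_sin_le1.
have i2 : (leb n.+1).-integrable S (EFin \o (fun v => w v ^+ 2 * cos (s * u v))).
  apply: (@bounded_integrable_ball _ _ _ 1).
    apply: measurable_funM; first exact: measurable_funX.
    by apply: measurable_cosT; exact: measurable_funM.
  move=> v /w1 wv; apply: normrM_le1; last exact: normr_cos_le1.
  by rewrite expr2; exact: normrM_le1.
have i1s : (leb n.+1).-integrable S (EFin \o (fun v => s * (u v * sin (s * u v)))).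
  apply: (@bounded_integrable_ball _ _ _ `|s|).
    apply: measurable_funM => //; apply: measurable_funM => //.
    by apply: measurable_sinT; exact: measurable_funM.
  move=> v /u1 uv; apply: normrM_le1 => //; apply: normrM_le1 => //.
  exact: normr_sin_le1.
have i2s : (leb n.+1).-integrable S (EFin \o (fun v => s ^+ 2 * (w v ^+ 2 * cos (s * u v)))).
  apply: (@bounded_integrable_ball _ _ _ `|s ^+ 2|).
    apply: measurable_funM => //; apply: measurable_funM; first exact: measurable_funX.
    by apply: measurable_cosT; exact: measurable_funM.
  move=> v /w1 wv; apply: normrM_le1 => //; apply: normrM_le1; last exact: normr_cos_le1.
  by rewrite expr2; exact: normrM_le1.
have E : \int[leb n.+1]_(v in S) f2 0 v =
   s * (\int[leb n.+1]_(v in S) (u v * sin (s * u v))) -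
   s ^+ 2 * \int[leb n.+1]_(v in S) (w v ^+ 2 * cos (s * u v)).
  rewrite -RintegralZl// -RintegralZl// -RintegralB//.
  apply: eq_Rintegral => v _; rewrite /f2 /ph /ph1 sin0 cos0.
  have -> : s * 1 * u v + s * 0 * w v = s * u v by ring.
  by ring.
move: f2_0; rewrite E => /eqP; rewrite subr_eq0 expr2 -mulrA => /eqP /(mulfI s0).
exact.
Qed.

Lemma Rintegral_sum_ball (I : Type) (r : seq I) (g : I -> T -> R) :
  (forall i, (leb n.+1).-integrable S (EFin \o g i)) ->
  (leb n.+1).-integrable S (EFin \o (fun v => \sum_(i <- r) g i v)) /\
  \int[leb n.+1]_(v in S) (\sum_(i <- r) g i v) =
  \sum_(i <- r) \int[leb n.+1]_(v in S) g i v.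
Proof.
have mS := @measurable_punctured_ball R n.+1.
move=> ig; elim: r => [|i r [IH1 IH2]].
  have -> : (fun v : T => \sum_(i <- [::]) g i v) = fun=> 0.
    by apply/funext => v; rewrite big_nil.
  split; first by apply: (@bounded_integrable_ball _ _ _ 0) => // v _; rewrite normr0.
  by rewrite big_nil Rintegral_cst// mul0r.
have -> : (fun v : T => \sum_(j <- i :: r) g j v) =
    (fun v => g i v + \sum_(j <- r) g j v).
  by apply/funext => v; rewrite big_cons.
split; last by rewrite big_cons RintegralD// IH2.
have := integrableD mS (ig i) IH1; apply: eq_integrable => //.
Qed.

(** Summing [sphere_tangential] over the n axes orthogonal to the first one
    replaces the square of the k-th coordinate of w by 1 - u^2, where u is the
    first coordinate. *)
Lemma sphere_ft_bessel (s : R) : 0 < s ->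
  sphere_ft2 s + 2 * (n%:R / 2) / s * sphere_ft1 s + sphere_ft s = 0.
Proof.
move=> s0; have sn0 : s != 0 by rewrite gt_eqF.
have mS := @measurable_punctured_ball R n.+1.
pose w (j : 'I_n) (v : T) := tnth (direction v) (lift ord0 j) ^+ 2 * cos (s * u v).
have iw j : (leb n.+1).-integrable S (EFin \o w j).
  apply: (@bounded_integrable_ball _ _ _ 1).
    apply: measurable_funM; first by apply: measurable_funX; exact: measurable_coord.
    by apply: measurable_cosT; exact: measurable_funM.
  move=> v Sv; apply: normrM_le1; last exact: normr_cos_le1.
  by rewrite expr2; apply: normrM_le1; exact: norm_tnth_direction.
have ic : (leb n.+1).-integrable S (EFin \o (fun v => cos (s * u v))).
  apply: (@bounded_integrable_ball _ _ _ 1).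
    by apply: measurable_cosT; exact: measurable_funM.
  by move=> v _; exact: normr_cos_le1.
have iu : (leb n.+1).-integrable S (EFin \o (fun v => - (u v ^+ 2 * cos (s * u v)))).
  apply: (@bounded_integrable_ball _ _ _ 1).
    apply: measurableT_comp => //; apply: measurable_funM; first exact: measurable_funX.
    by apply: measurable_cosT; exact: measurable_funM.
  move=> v /u1 uv; rewrite normrN; apply: normrM_le1; last exact: normr_cos_le1.
  by rewrite expr2; exact: normrM_le1.
have ius : (leb n.+1).-integrable S (EFin \o (fun v => u v * sin (s * u v))).
  apply: (@bounded_integrable_ball _ _ _ 1).
    by apply: measurable_funM => //; apply: measurable_sinT; exact: measurable_funM.
  by move=> v /u1 uv; apply: normrM_le1 => //; exact: normr_sin_le1.
have W : \sum_(j < n) \int[leb n.+1]_(v in S) w j v = sphere_ft s + sphere_ft2 s.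
  rewrite -(Rintegral_sum_ball _ iw).2 sphere_ftE /sphere_ft2 -RintegralD//.
  apply: eq_Rintegral => v; rewrite inE => Sv.
  rewrite -mulr_suml.
  have := dot_direction_self Sv; rewrite /dot big_ord_recl => E.
  have -> : \sum_(i < n) tnth (direction v) (lift ord0 i) ^+ 2 = 1 - u v ^+ 2.
    by rewrite -E /u; under [in RHS]eq_bigr do rewrite -expr2; rewrite -expr2 addrC addKr.
  by ring.
pose I := \int[leb n.+1]_(v in S) (u v * sin (s * u v)).
have IW j : \int[leb n.+1]_(v in S) w j v = I / s.
  by rewrite /I (@sphere_tangential s (lift ord0 j))// mulrC mulKf.
have I1 : sphere_ft1 s = - I.
  rewrite /sphere_ft1; under eq_Rintegral do rewrite -mulN1r.
  by rewrite RintegralZl// mulN1r.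
move: W; under eq_bigr do rewrite IW.
rewrite sumr_const card_ord -[I / s *+ n]mulr_natl I1 => W.
have -> : sphere_ft2 s = n%:R * (I / s) - sphere_ft s by rewrite W addrC addKr.
by field.
Qed.

End sphere_ode.

(** * Reduction to the Fourier transform of the sphere and to the radial variable *)

Section sphere_more.
Context {R : realType}.
Local Notation leb := (@lebesgue_tuple R).
Variable n : nat.
Local Notation T := (n.+1.-tuple R).
Local Notation S := (@punctured_ball R n.+1).

Lemma norm_dot_direction (x v : T) : S v -> `|dot x (direction v)| <= enorm x.
Proof.
move=> Sv; have [c cE] : exists c, c = dot x (direction v) by exists (dot x (direction v)).
rewrite -cE -sqrtr_sqr ler_sqrt ?dot_ge0//.
have : 0 <= \sum_i (tnth x i - c * tnth (direction v) i) ^+ 2.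
  by apply: sumr_ge0 => i _; exact: sqr_ge0.
have -> : \sum_i (tnth x i - c * tnth (direction v) i) ^+ 2 = dot x x - c ^+ 2.
  transitivity (dot x x - 2 * c * dot x (direction v) + c ^+ 2 * dot (direction v) (direction v)).
    rewrite /dot !mulr_sumr -sumrB -big_split; apply: eq_bigr => i _ /=.
    by ring.
  by rewrite dot_direction_self// -cE; ring.
by rewrite subr_ge0.
Qed.

(** The sine part vanishes: it is odd in x and depends only on the norm of x. *)
Lemma sphere_integralE (x : T) (al : R) :
  sphere_integral x al = cos al * sphere_ft n (enorm x).
Proof.
have E (y : T) a :
    sphere_integral y a = cos a * sphere_integral y 0 - sin a * sphere_integral y (- (pi / 2)).
  have i1 := bounded_integrable_ball (measurable_sphere_cos y 0) (fun v _ => normr_cos_le1 _).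
  have i2 := bounded_integrable_ball (measurable_sphere_cos y (- (pi / 2)))
    (fun v _ => normr_cos_le1 _).
  have mS := @measurable_punctured_ball R n.+1.
  have bd (c z : R) : `|c * cos z| <= `|c| by apply: normrM_le1 => //; exact: normr_cos_le1.
  have mc b c : measurable_fun setT (fun v : T => c * cos (dot y (direction v) + b)).
    by apply: measurable_funM => //; exact: measurable_sphere_cos.
  rewrite /sphere_integral -RintegralZl// -RintegralZl// -RintegralB//; last 2 first.
  - by apply: (bounded_integrable_ball (mc _ _)) => v _; exact: bd.
  - by apply: (bounded_integrable_ball (mc _ _)) => v _; exact: bd.
  by apply: eq_Rintegral => v _; rewrite addr0 cosBpihalf cosD; ring.
have s0 (y : T) : sphere_integral y (- (pi / 2)) = 0.
  pose y' := scale_tuple (-1) y.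
  have yy : enorm y = enorm y'.
    by rewrite /enorm /y' dot_scaler dot_scalel !mulN1r opprK.
  have i2 := bounded_integrable_ball (measurable_sphere_cos y (- (pi / 2)))
    (fun v _ => normr_cos_le1 _).
  have : sphere_integral y (- (pi / 2)) = - sphere_integral y (- (pi / 2)).
    rewrite [LHS](sphere_integral_rot _ yy) /sphere_integral -[RHS]mulN1r -RintegralZl//;
      last exact: measurable_punctured_ball.
    apply: eq_Rintegral => v _.
    by rewrite dot_scalel !cosBpihalf !mulN1r sinN.
  lra.
rewrite E s0 mulr0 subr0; congr (_ * _); apply: sphere_integral_rot.
by rewrite enorm_axis ger0_norm// enorm_ge0.
Qed.

Lemma norm_sphere_ft s : `|sphere_ft n s| <= fine (leb n.+1 S).
Proof. exact: sphere_integral_le. Qed.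

End sphere_more.

Section signed_polar.
Context {R : realType}.
Local Notation mu := (@lebesgue_measure R).
Local Notation leb := (@lebesgue_tuple R).
Variable n : nat.
Local Notation T := (n.+1.-tuple R).

(** From [ge0_integral_polar], applied to the positive and negative parts. *)
Lemma integral_polar (f : T -> R) : measurable_fun setT f ->
  (leb n.+1 \x mu)%E.-integrable setT
    (EFin \o (fun p => polar_weight p * f (polar_point p))) ->
  (leb n.+1).-integrable setT (EFin \o f) /\
  \int[leb n.+1]_v f v = n.+1%:R *
    \int[(leb n.+1 \x mu)%E]_p (polar_weight p * f (polar_point p)).
Proof.
move=> mf ig.
have abs (h : T -> R) : measurable_fun setT h -> (forall v, `|h v| <= `|f v|) ->
    (leb n.+1 \x mu)%E.-integrable setT
      (EFin \o (fun p => polar_weight p * h (polar_point p))).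
  move=> mh hf; apply: le_integrable ig => //.
    apply/measurable_EFinP; apply: measurable_funM; first exact: measurable_polar_weight.
    exact: (measurableT_comp mh (@measurable_polar_point R n)).
  move=> p _; rewrite /= lee_fin !normrM ler_wpM2l//.
have ge0 (h : T -> R) : measurable_fun setT h -> (forall v, 0 <= h v) ->
    (forall v, `|h v| <= `|f v|) ->
    (leb n.+1).-integrable setT (EFin \o h) /\
    \int[leb n.+1]_v h v = n.+1%:R *
      \int[(leb n.+1 \x mu)%E]_p (polar_weight p * h (polar_point p)).
  move=> mh h0 hf; have ih := abs h mh hf.
  have E : (\int[leb n.+1]_v (h v)%:E = n.+1%:R%:E *
      \int[(leb n.+1 \x mu)%E]_p (polar_weight p * h (polar_point p))%:E)%E.
    by rewrite (ge0_integral_polar (f := EFin \o h))//; exact/measurable_EFinP.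
  have fi := integrable_fin_num measurableT ih.
  split; last by rewrite /Rintegral E fineM.
  apply/integrableP; split; first exact/measurable_EFinP.
  under eq_integral => v _ do rewrite /= ger0_norm//.
  by rewrite E -(fineK fi) -EFinM ltry.
have mp : measurable_fun setT (fun v => Num.max (f v) 0).
  exact: measurable_maxr.
have mn : measurable_fun setT (fun v => Num.max (- f v) 0).
  by apply: measurable_maxr => //; exact: measurableT_comp.
have max0 (x : R) : 0 <= Num.max x 0 <= `|x|.
  by rewrite le_max lexx orbT ge_max ler_norm normr_ge0.
have maxE (x : R) : x = Num.max x 0 - Num.max (- x) 0.
  case/orP: (le_total 0 x) => x0.
    by rewrite (max_idPl x0) (max_idPr _) ?subr0// oppr_le0.
  by rewrite (max_idPr x0) (max_idPl _) ?sub0r ?opprK// oppr_ge0.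
have hp v : `|Num.max (f v) 0| <= `|f v|.
  by have /andP[h0 h1] := max0 (f v); rewrite ger0_norm.
have hn v : `|Num.max (- f v) 0| <= `|f v|.
  by have /andP[h0 h1] := max0 (- f v); rewrite ger0_norm// -[leRHS]normrN.
have [ip Ep] := ge0 _ mp (fun v => (andP (max0 (f v))).1) hp.
have [im Em] := ge0 _ mn (fun v => (andP (max0 (- f v))).1) hn.
have fE : f = fun v => Num.max (f v) 0 - Num.max (- f v) 0.
  by apply/funext => v; exact: maxE.
split.
  rewrite fE; have := integrableB measurableT ip im.
  exact: eq_integrable.
rewrite [in LHS]fE RintegralB// Ep Em -mulrBr; congr (_ * _).
rewrite -(RintegralB measurableT (abs _ mp hp) (abs _ mn hn)).
by apply: eq_Rintegral => p _; rewrite -mulrBr -maxE.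
Qed.

End signed_polar.

(** * The two regimes of the wave integral *)

Section wave_part.
Context {R : realType}.
Local Notation mu := (@lebesgue_measure R).
Local Notation leb := (@lebesgue_tuple R).
Variable n : nat.
Local Notation T := (n.+1.-tuple R).
Local Notation S := (@punctured_ball R n.+1).
Local Notation m := (n%:R / 2 : R).

(** The power of |xi| is written as in [cpow], so that the two agree at xi = 0
    too. *)
Definition wave_part (psi : R -> R) (ka : R) (x : T) (t al : R) (xi : T) : R :=
  expR (ln (enorm xi) * - ((n.+1%:R + 1) / 2)) *
  cos (dot x xi + t * enorm xi + ka * ln (enorm xi) + al) * psi (enorm xi).

Definition radial (psi : R -> R) (ka l al r : R) : R :=
  r `^ (m - 1) * (psi r * cos (phase ka l al r)).

Let I01 : set R := `]0, 1]%classic.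
Let mI01 : measurable I01. Proof. exact: measurable_itv. Qed.

(** [wave_part] in polar coordinates; the range of r stops at 1 because psi
    vanishes beyond. *)
Definition polar_part psi ka (x : T) t al (p : T * R) : R :=
  \1_S p.1 * (\1_I01 p.2 * radial psi ka (dot x (direction p.1) + t) al p.2).

Variable psi : R -> R.
Variable b : R.
Hypothesis b1 : b < 1.
Hypothesis psi0 : forall r, b < r -> psi r = 0.
Hypothesis kpsi : forall k, ncontdiff k psi.
Hypothesis n0 : (0 < n)%N.

Let m0 : 0 < m. Proof. by rewrite divr_gt0// ltr0n. Qed.

Let cpsi : continuous psi. Proof. exact: ncontdiff_continuous (kpsi 0%N). Qed.

Let mpsi : measurable_fun [set: R] psi. Proof. exact: continuous_measurable_fun. Qed.

Lemma polar_partE ka (x : T) t al p :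
  polar_weight p * wave_part psi ka x t al (polar_point p) =
  polar_part psi ka x t al p.
Proof.
case: p => v r; rewrite /polar_weight /polar_part /=.
case: (boolP (v \in S)) => vS; last by rewrite indicE (negbTE vS) !mul0r.
rewrite -mulrA; congr (_ * _).
rewrite !indicE mem_pos_line.
have rI : (r \in I01) = (0 < r <= 1).
  by apply/idP/idP; rewrite inE /I01 /= in_itv.
rewrite rI; case: (ltP 0 r) => r0 /=; last by rewrite !mul0r.
have Sv : S v by rewrite inE in vS.
have er : enorm (polar_point (v, r)) = r.
  rewrite /polar_point /= enorm_scale ?ltW// /enorm dot_direction_self// sqrtr1 mulr1//.
rewrite /wave_part er /polar_point /= dot_scaler.
have [r1|r1] := leP r 1; last first.
  by rewrite psi0 ?mulr0 ?mul0r// (lt_trans b1).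
rewrite !mul1r /radial.
have -> : expR (ln r * - ((n.+1%:R + 1) / 2)) = r `^ (- ((n.+1%:R + 1) / 2)).
  by rewrite /powR (gt_eqF r0) mulrC.
rewrite -!mulrA -powR_mulrn ?ltW// mulrA -powRD; last by rewrite (gt_eqF r0) implybT.
congr (_ `^ _ * _).
  by rewrite -natr1; field.
rewrite mulrC; congr (_ * cos _).
by rewrite /phase; ring.
Qed.

Let measurable_phaseT d (X : measurableType d) (l r : X -> R) (ka al : R) :
  measurable_fun setT l -> measurable_fun setT r ->
  measurable_fun setT (fun p => cos (phase ka (l p) al (r p))).
Proof.
move=> ml mr; apply: measurable_cosT.
apply: measurable_funD => //; apply: measurable_funD; first exact: measurable_funM.
by apply: measurable_funM => //; exact: measurableT_comp.
Qed.

Let measurable_radialT d (X : measurableType d) (l r : X -> R) (ka al : R) :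
  measurable_fun setT l -> measurable_fun setT r ->
  measurable_fun setT (fun p => radial psi ka (l p) al (r p)).
Proof.
move=> ml mr; apply: measurable_funM.
  by apply: (measurableT_comp (measurable_powR _)).
by apply: measurable_funM; [exact: measurableT_comp|exact: measurable_phaseT].
Qed.

Lemma measurable_polar_part ka (x : T) t al :
  measurable_fun [set: T * measurableTypeR R] (polar_part psi ka x t al).
Proof.
have m1 : measurable_fun [set: T * measurableTypeR R] (fun p : T * R => p.1).
  by exact: measurable_fst.
have m2 : measurable_fun [set: T * measurableTypeR R] (fun p : T * R => p.2).
  by exact: measurable_snd.
have mS : measurable_fun setT (\1_S : T -> R).
  by apply: measurable_indic; exact: measurable_punctured_ball.
have mI : measurable_fun [set: measurableTypeR R] (\1_I01 : R -> R).
  exact: measurable_indic.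
apply: measurable_funM; first exact: (measurableT_comp mS).
apply: measurable_funM; first exact: (measurableT_comp mI).
apply: measurable_radialT => //.
apply: measurable_funD => //.
apply: (measurableT_comp (f := fun v => dot x (direction v))) => //.
by apply: measurableT_comp; [exact: measurable_dot|exact: measurable_direction].
Qed.

(** The exponent m - 1 is greater than -1, and the ball has finite measure. *)
Lemma integrable_polar_part ka (x : T) t al :
  (leb n.+1 \x mu)%E.-integrable setT (EFin \o polar_part psi ka x t al).
Proof.
have [A A0 psiA] := continuous_bounded_itv 0 1 cpsi.
have mP := measurable_polar_part ka x t al.
apply/(integrable12ltyP (leb n.+1) mu); first exact/measurable_EFinP.
pose D (r : R) : \bar R := (r `^ (m - 1) * A)%:E.
have Di : mu.-integrable I01 D.
  by apply: (@integrable_powR _ 1 m A (fun=> A)) => // r _; rewrite ger0_norm.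
have mD : measurable_fun I01 D by exact: measurable_int Di.
pose c := fine (\int[mu]_(r in I01) D r)%E.
have cE : (\int[mu]_(r in I01) D r)%E = c%:E.
  by rewrite fineK//; exact: integrable_fin_num Di.
have c0 : 0 <= c.
  by apply: fine_ge0; apply: integral_ge0 => r _; rewrite lee_fin mulr_ge0 ?powR_ge0.
apply: (@le_lt_trans _ _ (\int[leb n.+1]_(v in S) c%:E)%E); last first.
  rewrite integral_cst; last exact: measurable_punctured_ball.
  by apply: lte_mul_pinfty => //; exact: lebesgue_tuple_punctured_ball_lty.
rewrite [leRHS]integral_mkcond; apply: ge0_le_integral => //.
- by move=> v _; exact: integral_ge0.
- apply: (@measurable_fun_fubini_tonelli_F _ _ T (measurableTypeR R) R mu
    (fun p => `|(polar_part psi ka x t al p)%:E|)%E) => //.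
  by apply: measurableT_comp => //; exact/measurable_EFinP.
- apply/(measurable_restrictT _ _).1 => //; exact: measurable_punctured_ball.
move=> v _; rewrite patchE; case: ifPn => vS; last first.
  by rewrite integral0_eq// => r _; rewrite /polar_part /= indicE (negbTE vS) mul0r normr0.
rewrite -cE [leRHS]integral_mkcond; apply: ge0_le_integral => //.
- apply: measurableT_comp => //; apply/measurable_EFinP.
  exact: (measurableT_comp mP (measurable_pair1 v)).
- exact/(measurable_restrictT _ _).1.
move=> r _; rewrite patchE /polar_part /= !indicE vS mul1r.
case: ifPn => rI; last by rewrite mul0r normr0.
have : I01 r by rewrite inE in rI.
rewrite /I01 /= in_itv/= => /andP[r0 r1].
rewrite mul1r lee_fin normrM ger0_norm ?powR_ge0// ler_wpM2l ?powR_ge0//.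
apply: normrM_le1; last exact: normr_cos_le1.
by apply: psiA; rewrite r1 ltW.
Qed.

Let V := fine (leb n.+1 S).

Let V0 : 0 <= V. Proof. by apply: fine_ge0; exact: measure_ge0. Qed.

Let VE : leb n.+1 S = V%:E.
Proof.
by rewrite /V fineK// ge0_fin_numE ?measure_ge0//; exact: lebesgue_tuple_punctured_ball_lty.
Qed.

Let measurable_radial ka l al :
  measurable_fun [set: R] (fun r => psi r * cos (phase ka l al r)).
Proof. by apply: measurable_funM => //; exact: measurable_phase_cos. Qed.

Lemma integral_polar_part_direction ka (x : T) t al (c : R) :
  (forall v, S v ->
    `|\int[mu]_(r in I01) radial psi ka (dot x (direction v) + t) al r| <= c) ->
  `|\int[(leb n.+1 \x mu)%E]_p polar_part psi ka x t al p| <= c * V.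
Proof.
move=> cv.
have iP := integrable_polar_part ka x t al.
have [A A0 psiA] := continuous_bounded_itv 0 1 cpsi.
pose F := fubini_F mu (EFin \o polar_part psi ka x t al).
have FE v : F v =
    (\1_S v * \int[mu]_(r in I01) radial psi ka (dot x (direction v) + t) al r)%:E.
  rewrite /F /fubini_F.
  case: (boolP (v \in S)) => vS; last first.
    by rewrite integral0_eq => [|r _]; rewrite /= /polar_part /= indicE (negbTE vS) !mul0r.
  rewrite indicE vS mul1r /Rintegral fineK; last first.
    apply: integrable_fin_num => //.
    apply: (@integrable_powR _ 1 m A) => // r /andP[r0 r1].
    by apply: normrM_le1; [apply: psiA; rewrite r1 ltW|exact: normr_cos_le1].
  rewrite [RHS]integral_mkcond; apply: eq_integral => r _.
  rewrite patchE /= /polar_part /= !indicE vS mul1r.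
  by case: ifPn => _; rewrite ?mul1r ?mul0r.
rewrite -lee_fin EFin_normr_Rintegral// -(integral12_prod_meas1 iP).
have mF := measurable_fubini_F iP.
apply: le_trans (le_abse_integral _ measurableT mF) _.
apply: (@le_trans _ _ (\int[leb n.+1]_(v in S) c%:E)%E); last first.
  rewrite integral_cst; last exact: measurable_punctured_ball.
  by rewrite EFinM -VE.
rewrite [leRHS]integral_mkcond; apply: ge0_le_integral => //.
- exact: measurableT_comp.
- by apply/(measurable_restrictT _ _).1 => //; exact: measurable_punctured_ball.
move=> v _; rewrite -/(F v) FE patchE indicE.
case: ifPn => vS; last by rewrite mul0r abse0.
by rewrite mul1r lee_fin; apply: cv; rewrite inE in vS.
Qed.

Lemma integral_polar_part_rad ka (x : T) t al :
  \int[(leb n.+1 \x mu)%E]_p polar_part psi ka x t al p =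
  \int[mu]_(r in I01)
    (r `^ (m - 1) * (psi r * cos (phase ka t al r) * sphere_ft n (r * enorm x))).
Proof.
have iP := integrable_polar_part ka x t al.
have mS := @measurable_punctured_ball R n.+1.
rewrite /Rintegral -(integral21_prod_meas1 iP); congr fine.
rewrite [RHS]integral_mkcond; apply: eq_integral => r _.
rewrite /fubini_G patchE; case: ifPn => rI; last first.
  rewrite integral0_eq// => v _.
  by rewrite /= /polar_part /= [\1_I01 _]indicE (negbTE rI) mul0r mulr0.
have : I01 r by rewrite inE in rI.
rewrite /I01 /= in_itv/= => /andP[r0 r1].
have -> : (\int[leb n.+1]_v (polar_part psi ka x t al (v, r))%:E =
  \int[leb n.+1]_(v in S) ((r `^ (m - 1) * psi r) *
     cos (dot (scale_tuple r x) (direction v) + phase ka t al r))%:E)%E.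
  rewrite [RHS]integral_mkcond; apply: eq_integral => v _.
  rewrite patchE /polar_part /radial /= !indicE rI mul1r.
  case: ifPn => _; rewrite ?mul0r// mul1r mulrA dot_scalel.
  by congr ((_ * cos _)%:E); rewrite /phase; ring.
have i1 := bounded_integrable_ball (measurable_sphere_cos (scale_tuple r x) (phase ka t al r))
  (fun v _ => normr_cos_le1 _).
rewrite -[LHS]fineK; last first.
  apply: integrable_fin_num => //.
  apply: (@bounded_integrable_ball _ _ _ `|r `^ (m - 1) * psi r|).
    by apply: measurable_funM => //; exact: measurable_sphere_cos.
  by move=> v _; apply: normrM_le1 => //; exact: normr_cos_le1.
rewrite -/(Rintegral _ _ _) RintegralZl// -/(sphere_integral _ _) sphere_integralE enorm_scale ?ltW//.
by rewrite !mulrA.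
Qed.

Lemma measurable_wave_part ka (x : T) t al :
  measurable_fun setT (wave_part psi ka x t al).
Proof.
have me := @measurable_enorm R n.+1.
have ml : measurable_fun setT (fun v : T => ln (enorm v)).
  exact: (measurableT_comp (@measurable_ln R)).
apply: measurable_funM; last exact: measurableT_comp.
apply: measurable_funM.
  by apply: measurableT_comp => //; exact: measurable_funM.
apply: measurable_cosT; apply: measurable_funD => //.
apply: measurable_funD; last exact: measurable_funM.
by apply: measurable_funD; [exact: measurable_dot|exact: measurable_funM].
Qed.

Lemma wave_part_polar ka (x : T) t al :
  (leb n.+1).-integrable setT (EFin \o wave_part psi ka x t al) /\
  \int[leb n.+1]_v wave_part psi ka x t al v = n.+1%:R *
    \int[(leb n.+1 \x mu)%E]_p polar_part psi ka x t al p.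
Proof.
have E : (fun p => polar_weight p * wave_part psi ka x t al (polar_point p)) =
  polar_part psi ka x t al by apply/funext => p; exact: polar_partE.
have := integral_polar (measurable_wave_part ka x t al).
by rewrite E; apply; exact: integrable_polar_part.
Qed.

(** If |x| <= |t| / 2 the radial integral decays uniformly in the direction;
    otherwise the integral over directions is computed first, and the decay in
    |x| is used. *)
Lemma wave_part_bound : exists C : R, exists N : nat, 0 <= C /\
  forall ka (x : T) t al, t != 0 ->
    `|ka * \int[leb n.+1]_v wave_part psi ka x t al v| <=
    C * (1 + `|ka|) ^+ N * `|t| `^ (- m).
Proof.
have [C1 [N1 [C10 H1]]] := osc_symbol_decay m0 b1 kpsi psi0.
have [psi' dpsi cpsi'] := kpsi 1.
have [C2 C20 H2] := osc_bessel m0 dpsi cpsi' (der_sphere_ft n) (der_sphere_ft1 n)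
  (@sphere_ft_bessel R n) (@norm_sphere_ft R n).
exists (n.+1%:R * (C1 * V + C2) * 2 `^ m), (N1 + 2)%N; split.
  by rewrite !mulr_ge0 ?addr_ge0 ?mulr_ge0 ?powR_ge0.
move=> ka x t al t0.
have [_ ->] := wave_part_polar ka x t al.
have t20 : 0 < `|t| / 2 by rewrite divr_gt0 ?normr_gt0.
have mono l : `|t| / 2 <= l -> l `^ (- m) <= 2 `^ m * `|t| `^ (- m).
  move=> tl; have l0 : 0 < l by exact: lt_le_trans tl.
  have -> : 2 `^ m * `|t| `^ (- m) = (`|t| / 2) `^ (- m).
    by rewrite powRM// -powR_inv1// -[in RHS]powRrM mulN1r opprK mulrC.
  rewrite !powRN lef_pV2 ?posrE ?powR_gt0//.
  by rewrite ge0_ler_powR ?nnegrE// ltW.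
have q1 : 1 <= 1 + `|ka| by rewrite lerDl.
have k0 : 0 <= `|ka| by [].
pose q := 1 + `|ka|.
have q0 : 0 <= q by rewrite addr_ge0.
set u := 2 `^ m * `|t| `^ (- m) in mono.
have u0 : 0 <= u by rewrite mulr_ge0 ?powR_ge0.
suff : `|ka * \int[(leb n.+1 \x mu)%E]_p polar_part psi ka x t al p| <=
    (C1 * V + C2) * q ^+ (N1 + 2) * u.
  move=> H; rewrite mulrCA normrM (ger0_norm (ler0n _ _)).
  apply: le_trans (ler_wpM2l (ler0n _ _) H) _.
  by rewrite /u /q; rewrite le_eqVlt; apply/orP; left; apply/eqP; ring.
have qN k : (k <= N1 + 2)%N -> q ^+ k <= q ^+ (N1 + 2) by move=> ?; exact: ler_weXn2l.
have [xt|xt] := leP (enorm x) (`|t| / 2).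
  have := @integral_polar_part_direction ka x t al (C1 * q ^+ N1 * u).
  move=> H; rewrite normrM.
  have {}H := H _.
  apply: (@le_trans _ _ (q * (C1 * q ^+ N1 * u * V))).
    apply: ler_pM => //; first by rewrite lerDr.
    apply: H => v Sv.
    have lt : `|t| / 2 <= `|dot x (direction v) + t|.
      have := norm_dot_direction x Sv; have := ler_normB (dot x (direction v) + t) (dot x (direction v)).
      by rewrite addrAC subrr add0r; lra.
    have l0 : dot x (direction v) + t != 0 by rewrite -normr_gt0 (lt_le_trans t20).
    apply: le_trans (H1 ka al _ l0) _.
    by rewrite ler_wpM2l ?mulr_ge0 ?exprn_ge0// mono.
  have -> : q * (C1 * q ^+ N1 * u * V) = (C1 * V) * q ^+ N1.+1 * u by rewrite exprS; ring.
  rewrite ler_wpM2r// ler_pM ?mulr_ge0 ?exprn_ge0//; first by rewrite lerDl.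
  by apply: qN; rewrite addn2.
have X0 : 0 < enorm x by exact: lt_trans xt.
have [A A0 psiA] := continuous_bounded_itv 0 1 cpsi.
have csph : continuous (@sphere_ft R n) by move=> s; exact: der_continuous (der_sphere_ft n s).
rewrite integral_polar_part_rad -RintegralZl//; last first.
  apply: (@integrable_powR _ 1 m (A * V)) => //.
    apply: measurable_funM => //; apply: measurableT_comp.
      exact: continuous_measurable_fun.
    exact: measurable_funM.
  move=> r /andP[r0 r1]; rewrite normrM; apply: ler_pM => //; last exact: norm_sphere_ft.
  by apply: normrM_le1; [apply: psiA; rewrite r1 ltW|exact: normr_cos_le1].
under eq_Rintegral do rewrite mulrCA.
apply: le_trans (H2 ka al t (enorm x) X0) _.
rewrite -/q; apply: (@le_trans _ _ (C2 * q ^+ 2 * u)).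
  by rewrite ler_wpM2l ?mulr_ge0 ?exprn_ge0// mono// ltW.
rewrite ler_wpM2r// ler_pM ?exprn_ge0//; first by rewrite lerDr mulr_ge0.
by apply: qN; rewrite leq_addl.
Qed.

End wave_part.

(** * The wave kernel *)

Section reduction.
Context {R : realType}.
Local Open Scope complex_scope.

(** The point 1 is not in the support, which is closed. *)
Lemma test_function_vanish (chi : R -> R[i]) : test_function `]-1, 1[ chi ->
  exists2 b : R, b < 1 & forall r, b < r -> chi r = 0.
Proof.
move=> [_ _ _ sub].
set Z := closure _ in sub.
have Z1 : ~ Z 1 by move=> /sub; rewrite /= in_itv/= ltxx andbF.
have : nbhs (1 : R) (~` Z) by apply: open_nbhs_nbhs; split => //;
  apply/closed_openC/closed_closure.
move=> /nbhs_ballP[e /= e0 eZ].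
exists (1 - e); first by rewrite gtrBl.
move=> r er; apply/eqP/negPn/negP => r0.
have Zr : Z r by apply: subset_closure.
have [r1|r1] := leP 1 r.
  by have := sub _ Zr; rewrite /= in_itv/= [r < 1]ltNge r1 andbF.
apply: (eZ r) => //; rewrite /ball/= ger0_norm ?subr_ge0 ?ltW//.
by rewrite ltrBlDr -ltrBlDl.
Qed.

Lemma normc_le (a b : R) : Normc.normc (a +i* b) <= `|a| + `|b|.
Proof.
rewrite /Normc.normc -[leRHS]ger0_norm ?addr_ge0// -sqrtr_sqr ler_sqrt ?sqr_ge0//.
rewrite sqrrD !real_normK ?num_real// lerD2r lerDl mulrn_wge0// mulr_ge0//.
Qed.

(** The phase shifts by pi / 2 and - (pi / 2) stand for - sin and sin. *)
Lemma wave_kernel_parts n (chi : R -> R[i]) ka (x xi : n.+1.-tuple R) t :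
  let f := fun xi => expc (0 +i* (dot x xi + t * enorm xi)) *
    cpow (enorm xi) (- ((n.+1%:R + 1) / 2) +i* ka) * chi (enorm xi) in
  let psi1 := fun r => complex.Re (chi r) in
  let psi2 := fun r => complex.Im (chi r) in
  complex.Re (f xi) =
    wave_part psi1 ka x t 0 xi + wave_part psi2 ka x t (pi / 2) xi /\
  complex.Im (f xi) =
    wave_part psi2 ka x t 0 xi + wave_part psi1 ka x t (- (pi / 2)) xi.
Proof.
move=> f psi1 psi2.
rewrite /f /wave_part /psi1 /psi2; case: (chi _) => c1 c2.
rewrite cosDpihalf cosBpihalf addr0 /cpow /expc /=; simpc => /=.
set th := dot x xi + t * enorm xi.
by rewrite expR0 [ka * _]mulrC cosD sinD; split; ring.
Qed.

End reduction.

Theorem proposition3p1 (R : realType) (d : nat) (chi : R -> R[i]) :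
  (2 <= d)%N ->
  test_function `]-1, 1[ chi ->
  (forall r : R, - (1 / 2) < r < 1 / 2 -> chi r = 1) ->
  exists C N : R, 0 < N /\
    forall (kappa : R) (x : d.-tuple R) (t : R),
      ((Normc.normc (real_complex R kappa * wave_kernel chi kappa x t))%:E <=
       if t == 0%R then +oo
       else (C * (1 + `|kappa|) `^ N * `|t| `^ (- ((d%:R - 1) / 2)))%:E)%E.
Proof.
case: d => [//|[//|d']] _ tchi _.
set n := d'.+1.
have [b b1 chi0] := test_function_vanish tchi.
have [s1 s2 _ _] := tchi.
pose psi1 r := complex.Re (chi r); pose psi2 r := complex.Im (chi r).
have k1 k : ncontdiff k psi1 by exact: smooth_ncontdiff.
have k2 k : ncontdiff k psi2 by exact: smooth_ncontdiff.
have z1 r : b < r -> psi1 r = 0 by move=> br; rewrite /psi1 chi0.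
have z2 r : b < r -> psi2 r = 0 by move=> br; rewrite /psi2 chi0.
have n0 : (0 < n)%N by [].
have [C1 [N1 [C10 H1]]] := wave_part_bound b1 z1 k1 n0.
have [C2 [N2 [C20 H2]]] := wave_part_bound b1 z2 k2 n0.
exists (2 * (C1 + C2)), (N1 + N2).+1%:R; split => // ka x t.
case: ifPn => [_|t0]; first exact: leey.
rewrite lee_fin powR_mulrn ?addr_ge0//.
have -> : (n.+1%:R - 1) / 2 = n%:R / 2 :> R by rewrite -natr1 addrK.
have I1 al := (wave_part_polar b1 z1 k1 n0 ka x t al).1.
have I2 al := (wave_part_polar b1 z2 k2 n0 ka x t al).1.
have WE : wave_kernel chi ka x t = Complex
   (\int[lebesgue_tuple n.+1]_v wave_part psi1 ka x t 0 v +
    \int[lebesgue_tuple n.+1]_v wave_part psi2 ka x t (pi / 2) v)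
   (\int[lebesgue_tuple n.+1]_v wave_part psi2 ka x t 0 v +
    \int[lebesgue_tuple n.+1]_v wave_part psi1 ka x t (- (pi / 2)) v).
  rewrite -!RintegralD//.
  by congr Complex; apply: eq_Rintegral => v _;
     have [E1 E2] := wave_kernel_parts chi ka x v t.
rewrite WE.
set a1 := Rintegral _ _ _; set a2 := Rintegral _ _ _.
set a3 := Rintegral _ _ _; set a4 := Rintegral _ _ _.
have -> : real_complex R ka * Complex (a1 + a2) (a3 + a4) =
    Complex (ka * (a1 + a2)) (ka * (a3 + a4)).
  by simpc.
apply: le_trans (normc_le _ _) _.
have h1 := H1 ka x t 0 t0; have h2 := H2 ka x t (pi / 2) t0.
have h3 := H2 ka x t 0 t0; have h4 := H1 ka x t (- (pi / 2)) t0.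
rewrite -/a1 in h1; rewrite -/a2 in h2; rewrite -/a3 in h3; rewrite -/a4 in h4.
set q := 1 + `|ka| in h1 h2 h3 h4 *.
have q1 : 1 <= q by rewrite lerDl.
set u := _ `^ _ in h1 h2 h3 h4 *.
have u0 : 0 <= u by exact: powR_ge0.
have up (C : R) k : 0 <= C -> (k <= (N1 + N2).+1)%N ->
    C * q ^+ k * u <= C * q ^+ (N1 + N2).+1 * u.
  by move=> C0 kN; rewrite ler_wpM2r// ler_wpM2l// ler_weXn2l.
have e1 := up C1 N1 C10 (leqW (leq_addr _ _)).
have e2 := up C2 N2 C20 (leqW (leq_addl _ _)).
rewrite !mulrDr.
have n1 := ler_normD (ka * a1) (ka * a2); have n2 := ler_normD (ka * a3) (ka * a4).
rewrite -!mulrA in h1 h2 h3 h4 e1 e2 *.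
lra.
Qed.
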